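(* Let $\alpha\in[0,1]$ and $\rho>0$. If $f\in C^{10}[0,1]$ and $x\in[0,1]$, then, as $n\to\infty$ (for sufficiently large $n$), $$\tilde{J}_{n,\alpha,\rho}^{M,3}(f;x)-f(x)=O\!\left(\frac{1}{n^3}\right).$$
   Context: Fix $\alpha\in[0,1]$ and $\rho>0$. For $x\in[0,1]$ let $p_{1,0,\alpha}(x)=1-x$, $p_{1,1,\alpha}(x)=x$, and for $m\ge 2$, $0\le k\le m$, $$p_{m,k,\alpha}(x)=\left[\binom{m-2}{k}(1-\alpha)x+\binom{m-2}{k-2}(1-\alpha)(1-x)+\binom{m}{k}\alpha x(1-x)\right]x^{k-1}(1-x)^{m-k-1}$$ (understood as a polynomial in $x$, with $\binom{r}{s}=0$ if $s<0$ or $s>r$); $p_{m,k,\alpha}=0$ if $k<0$ or $k>m$. Let $$\mu_{n,k}^\rho(t)=\frac{t^{k\rho}(1-t)^{(n-k)\rho}}{B(k\rho+1,(n-k)\rho+1)},\quad t\in[0,1],$$ where $B$ is the Beta function. For $n\ge5$ the third order $\alpha$-Bernstein–Păltănea operators are $$\begin{aligned}\tilde{J}_{n,\alpha,\rho}^{M,3}(f;x)=\sum_{k=0}^n\Bigl[&\tilde a(x,n)p_{n-4,k,\alpha}(x)+\tilde b(x,n)p_{n-4,k-1,\alpha}(x)+\tilde d(x,n)p_{n-4,k-2,\alpha}(x)\\&+\tilde b(1-x,n)p_{n-4,k-3,\alpha}(x)+\tilde a(1-x,n)p_{n-4,k-4,\alpha}(x)\Bigr]\int_0^1\mu_{n,k}^\rho(t)f(t)\,dt,\end{aligned}$$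 where $\tilde a(x,n)=\sum_{i=0}^4\tilde a_i(n)x^i$, $\tilde b(x,n)=\sum_{i=0}^4\tilde b_i(n)x^i$, $\tilde d(x,n)=\tilde d_0(n)x^2(1-x)^2$, with coefficients (chosen so that the operators reproduce $1,x,x^2,x^3$) $$\tilde a_0(n)=\frac{12\rho^3+19\rho^2+8\rho+1}{12\rho^3},$$ $$\tilde a_1(n)=-\frac{7\rho^2+11\rho+4}{12\rho^2}n-\frac{(29-5\alpha)\rho^3+(48-3\alpha)\rho^2+30\rho+7}{6\rho^3},$$ $$\tilde a_2(n)=\frac{(1+\rho)^2}{8\rho^2}n^2+\frac{17\rho^2+29\rho+12}{12\rho^2}n+\frac{(41-11\alpha)\rho^3+(79-9\alpha)\rho^2+60\rho+18}{6\rho^3},$$ $$\tilde a_3(n)=-\frac{(1+\rho)^2}{4\rho^2}n^2-\frac{5\rho^2+9\rho+4}{6\rho^2}n-\frac{(3-\alpha)\rho^3+(7-\alpha)\rho^2+6\rho+2}{\rho^3},$$ $$\tilde a_4(n)=\frac{(1+\rho)^2}{8\rho^2}n^2,\qquad \tilde b_0(n)=-\frac{12\rho^2+7\rho+1}{6\rho^3},$$ $$\tilde b_1(n)=\frac{3\rho^2+5\rho+2}{3\rho^2}n+\frac{(16-4\alpha)\rho^3+(37-3\alpha)\rho^2+27\rho+7}{3\rho^3},$$ $$\tilde b_2(n)=-\frac{(1+\rho)^2}{2\rho^2}n^2-\frac{8\rho^2+14\rho+6}{3\rho^2}n-\frac{(34-10\alpha)\rho^3+(71-9\alpha)\rho^2+57\rho+18}{3\rho^3},$$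 $$\tilde b_3(n)=\frac{(1+\rho)^2}{\rho^2}n^2+\frac{5\rho^2+9\rho+4}{3\rho^2}n+\frac{2\bigl((3-\alpha)\rho^3+(7-\alpha)\rho^2+6\rho+2\bigr)}{\rho^3},$$ $$\tilde b_4(n)=-\frac{(1+\rho)^2}{2\rho^2}n^2,\qquad \tilde d_0(n)=\frac{3(1+\rho)^2}{4\rho^2}n^2 .$$ *)

(* Defs.v *)
(* MathComp-Analysis *)
From HB Require Import structures.
From mathcomp Require Export all_boot all_order all_algebra.
From mathcomp Require Export all_classical all_reals all_analysis.
Export Order.TTheory GRing.Theory Num.Theory.
Export numFieldNormedType.Exports.

Set Implicit Arguments.
Unset Strict Implicit.
Unset Printing Implicit Defensive.

Global Open Scope classical_set_scope.
Global Open Scope ring_scope.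

(* Derivative relative to A: at an endpoint of A = [0, 1] the limit of the
   difference quotient is one-sided. *)
Definition has_derivative_on (R : realType) (A : set R) (f g : R -> R) : Prop :=
  forall x, A x ->
    (f y - f x) / (y - x) @[y --> within A (dnbhs x)] --> g x.

Fixpoint continuously_differentiable_on (R : realType) (A : set R) (k : nat)
    (f : R -> R) : Prop :=
  match k with
  | 0 => {within A, continuous f}
  | k'.+1 => exists g : R -> R,
      has_derivative_on A f g /\ continuously_differentiable_on A k' g
  end.

(* p_{m,k,alpha}.  For m >= 2 the factor x^(k-1) (1-x)^(m-k-1) is distributed
   over the bracket, so that every exponent is a natural number.  A truncated
   exponent occurs only in a term whose binomial coefficient is 0, and all terms
   vanish for k > m.  No meaning is intended for m = 0. *)
Definition alpha_bernstein (R : realType) (alpha : R) (m k : nat) (x : R) : R :=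
  match m with
  | 0 => 0
  | 1 => match k with 0 => 1 - x | 1 => x | _ => 0 end
  | m'.+2 =>
      'C(m', k)%:R * (1 - alpha) * (x ^+ k * (1 - x) ^+ (m - k - 1))
      + (if (2 <= k)%N then 'C(m', k - 2)%:R else 0) * (1 - alpha)
        * (x ^+ (k - 1) * (1 - x) ^+ (m - k))
      + 'C(m, k)%:R * alpha * (x ^+ k * (1 - x) ^+ (m - k))
  end.

(* p_{m,k-i,alpha}, with value 0 for a negative index k - i. *)
Definition alpha_bernstein_shift (R : realType) (alpha : R) (m k i : nat)
    (x : R) : R :=
  if (i <= k)%N then alpha_bernstein alpha m (k - i) x else 0.

(* The Beta function with real arguments; the library's [beta_fun] takes
   natural numbers only. *)
Definition euler_beta (R : realType) (a b : R) : R :=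
  \int[lebesgue_measure]_(t in `[0, 1]) (t `^ (a - 1) * (1 - t) `^ (b - 1)).

Definition paltanea_density (R : realType) (rho : R) (n k : nat) (t : R) : R :=
  t `^ (k%:R * rho) * (1 - t) `^ ((n - k)%:R * rho)
  / euler_beta (k%:R * rho + 1) ((n - k)%:R * rho + 1).

Definition coef_a0 (R : realType) (rho : R) : R :=
  (12 * rho ^+ 3 + 19 * rho ^+ 2 + 8 * rho + 1) / (12 * rho ^+ 3).

Definition coef_a1 (R : realType) (alpha rho : R) (n : nat) : R :=
  - ((7 * rho ^+ 2 + 11 * rho + 4) / (12 * rho ^+ 2)) * n%:R
  - ((29 - 5 * alpha) * rho ^+ 3 + (48 - 3 * alpha) * rho ^+ 2 + 30 * rho + 7)
    / (6 * rho ^+ 3).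

Definition coef_a2 (R : realType) (alpha rho : R) (n : nat) : R :=
  (1 + rho) ^+ 2 / (8 * rho ^+ 2) * n%:R ^+ 2
  + (17 * rho ^+ 2 + 29 * rho + 12) / (12 * rho ^+ 2) * n%:R
  + ((41 - 11 * alpha) * rho ^+ 3 + (79 - 9 * alpha) * rho ^+ 2 + 60 * rho + 18)
    / (6 * rho ^+ 3).

Definition coef_a3 (R : realType) (alpha rho : R) (n : nat) : R :=
  - ((1 + rho) ^+ 2 / (4 * rho ^+ 2)) * n%:R ^+ 2
  - (5 * rho ^+ 2 + 9 * rho + 4) / (6 * rho ^+ 2) * n%:R
  - ((3 - alpha) * rho ^+ 3 + (7 - alpha) * rho ^+ 2 + 6 * rho + 2) / rho ^+ 3.

Definition coef_a4 (R : realType) (rho : R) (n : nat) : R :=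
  (1 + rho) ^+ 2 / (8 * rho ^+ 2) * n%:R ^+ 2.

Definition coef_b0 (R : realType) (rho : R) : R :=
  - ((12 * rho ^+ 2 + 7 * rho + 1) / (6 * rho ^+ 3)).

Definition coef_b1 (R : realType) (alpha rho : R) (n : nat) : R :=
  (3 * rho ^+ 2 + 5 * rho + 2) / (3 * rho ^+ 2) * n%:R
  + ((16 - 4 * alpha) * rho ^+ 3 + (37 - 3 * alpha) * rho ^+ 2 + 27 * rho + 7)
    / (3 * rho ^+ 3).

Definition coef_b2 (R : realType) (alpha rho : R) (n : nat) : R :=
  - ((1 + rho) ^+ 2 / (2 * rho ^+ 2)) * n%:R ^+ 2
  - (8 * rho ^+ 2 + 14 * rho + 6) / (3 * rho ^+ 2) * n%:R
  - ((34 - 10 * alpha) * rho ^+ 3 + (71 - 9 * alpha) * rho ^+ 2 + 57 * rho + 18)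
    / (3 * rho ^+ 3).

Definition coef_b3 (R : realType) (alpha rho : R) (n : nat) : R :=
  (1 + rho) ^+ 2 / rho ^+ 2 * n%:R ^+ 2
  + (5 * rho ^+ 2 + 9 * rho + 4) / (3 * rho ^+ 2) * n%:R
  + 2 * ((3 - alpha) * rho ^+ 3 + (7 - alpha) * rho ^+ 2 + 6 * rho + 2)
    / rho ^+ 3.

Definition coef_b4 (R : realType) (rho : R) (n : nat) : R :=
  - ((1 + rho) ^+ 2 / (2 * rho ^+ 2)) * n%:R ^+ 2.

Definition coef_d0 (R : realType) (rho : R) (n : nat) : R :=
  3 * (1 + rho) ^+ 2 / (4 * rho ^+ 2) * n%:R ^+ 2.

Definition coef_a (R : realType) (alpha rho : R) (n : nat) (x : R) : R :=
  coef_a0 rho + coef_a1 alpha rho n * x + coef_a2 alpha rho n * x ^+ 2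
  + coef_a3 alpha rho n * x ^+ 3 + coef_a4 rho n * x ^+ 4.

Definition coef_b (R : realType) (alpha rho : R) (n : nat) (x : R) : R :=
  coef_b0 rho + coef_b1 alpha rho n * x + coef_b2 alpha rho n * x ^+ 2
  + coef_b3 alpha rho n * x ^+ 3 + coef_b4 rho n * x ^+ 4.

Definition coef_d (R : realType) (rho : R) (n : nat) (x : R) : R :=
  coef_d0 rho n * x ^+ 2 * (1 - x) ^+ 2.

Definition basis_J (R : realType) (alpha rho : R) (n k : nat) (x : R) : R :=
  coef_a alpha rho n x * alpha_bernstein_shift alpha (n - 4) k 0 x
  + coef_b alpha rho n x * alpha_bernstein_shift alpha (n - 4) k 1 x
  + coef_d rho n x * alpha_bernstein_shift alpha (n - 4) k 2 x
  + coef_b alpha rho n (1 - x) * alpha_bernstein_shift alpha (n - 4) k 3 x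
  + coef_a alpha rho n (1 - x) * alpha_bernstein_shift alpha (n - 4) k 4 x.

(* The third order alpha-Bernstein-Paltanea operator.  It is meaningful for
   n >= 5 only, since n - 4 is truncated for smaller n. *)
Definition bernstein_paltanea_J3 (R : realType) (alpha rho : R) (n : nat)
    (f : R -> R) (x : R) : R :=
  \sum_(0 <= k < n.+1)
    basis_J alpha rho n k x
    * \int[lebesgue_measure]_(t in `[0, 1]) (paltanea_density rho n k t * f t).

(* Main.v *)
Require Import Defs.
From mathcomp Require Import ring lra zify.

Set Implicit Arguments.
Unset Strict Implicit.
Unset Printing Implicit Defensive.

(** The operator averages the means G(k) of f against Beta densities.  Writing
    n = N + 6, it is the alpha-Bernstein average of order n - 4 of a five-point
    stencil applied to G ([sum_basis_J]), and the alpha-Bernstein average is a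
    binomial average over N trials of a mixture of shifts.  Expand f at x.

    Powers (t - x)^j.  Give weight 1 to z = k - (n - 4) x and weight 2 to n.  A
    forward difference in k lowers the weight by one, and the average of a
    polynomial of weight w is O(n^floor(w/2)), because by Stein's identity for
    the binomial law every factor n is paid for with two factors z
    ([bernstein_mean_growth]).  The Beta mean of (t - x)^j is a polynomial of
    weight j over a rising factorial of size n^j ([graded_paltanea_num],
    [paltanea_mean_center]).  The coefficients of the stencil are as large as
    n^2, but its Newton form is 1 + c1 D + c2 D^2 + c3 D^3 + c4 D^4 with D the
    forward difference, c1 constant, c2 and c3 affine and c4 quadratic in n
    ([stencil_newton]).  Hence the stencil preserves the weight
    ([graded_stencil]), and (t - x)^j contributes O(n^(floor(j/2) - j)), which
    is O(n^-3) for j >= 5.  For j = 1, 2, 3 the contribution vanishes: c1, c2,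
    c3 are the coefficients that make it vanish.  For j = 4 it would be of order
    n^-2, and the leading coefficient of c4 is the one that cancels that term
    ([stencil_moment4]).

    Remainder.  The Taylor remainder is not a polynomial, so differences give
    nothing and the n^2 of the coefficients is lost entirely.  A remainder
    bounded by (t - x)^10 has mean O(n^-5), which leaves n^-3
    ([stencil_remainder_decay]); this is where ten derivatives are used. *)

(** * Taylor expansion on the unit interval *)

Section Taylor.
Context {R : realType}.
Implicit Types (f g : R -> R) (A : set R).

Lemma has_derivative_onP A f g x e :
  has_derivative_on A f g -> A x -> 0 < e ->
  exists2 d, 0 < d & forall y, A y -> `|y - x| < d ->
    `|f y - f x - g x * (y - x)| <= e * `|y - x|.
Proof.
move=> fg Ax e0.
have /cvgrPdist_lt /(_ e e0) := fg x Ax.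
rewrite /prop_near1 /within /dnbhs /= /within /= => /nbhs_ballP [d /= d0 dP].
exists d => // y Ay yx.
have [->|yx0] := eqVneq y x; first by rewrite !subrr mulr0 subr0 normr0 mulr0.
have yx1 : y - x != 0 by rewrite subr_eq0.
have := dP y; rewrite /ball /= distrC => /(_ yx yx0 Ay) /ltW.
rewrite distrC => H.
have -> : f y - f x - g x * (y - x) = ((f y - f x) / (y - x) - g x) * (y - x).
  by field.
by rewrite normrM ler_wpM2r.
Qed.

Lemma has_derivative_on_continuous A f g :
  has_derivative_on A f g -> {within A, continuous f}.
Proof.
move=> fg; apply/subspace_continuousP => x Ax; apply/cvgrPdist_lt => e e0.
have [d d0 dP] := has_derivative_onP fg Ax ltr01.
pose c := 1 + `|g x|.
have c0 : 0 < c by rewrite ltr_pwDl.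
rewrite /prop_near1 /within /=; apply/nbhs_ballP.
exists (Num.min d (e / c)) => /=; first by rewrite lt_min d0 divr_gt0.
move=> y; rewrite /ball /= distrC lt_min => /andP[yd ye] Ay.
rewrite distrC.
have -> : f y - f x = (f y - f x - g x * (y - x)) + g x * (y - x) by ring.
rewrite (le_lt_trans (ler_normD _ _)) // (@le_lt_trans _ _ (c * `|y - x|)) //.
  by rewrite mulrDl lerD ?dP // normrM.
by rewrite mulrC -ltr_pdivlMr.
Qed.

Lemma has_derivative_on_is_derive f g (x : R) :
  has_derivative_on `[0, 1] f g -> 0 < x < 1 -> is_derive x 1 f (g x).
Proof.
move=> fg /andP[x0 x1].
have Ax : `[0, 1]%classic x by rewrite /= in_itv /= !ltW.
suff cv : (h^-1 *: (f (h *: 1 + x) - f x)) @[h --> 0^'] --> g x.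
  apply: DeriveDef; first by apply/cvg_ex; exists (g x).
  exact/cvg_lim.
apply/cvgrPdist_le => e e0.
have [d d0 dP] := has_derivative_onP fg Ax e0.
rewrite /prop_near1 /dnbhs /within /=; apply/nbhs_ballP.
exists (Num.min d (Num.min x (1 - x))) => /=.
  by rewrite !lt_min d0 x0 subr_gt0.
move=> h; rewrite /ball /= sub0r normrN !lt_min => /and3P[hd hx hx1] h0.
have hE : h *: (1 : R) = h by rewrite /GRing.scale /= mulr1.
rewrite hE distrC.
have -> : h^-1 *: (f (h + x) - f x) - g x = h^-1 * (f (h + x) - f x - g x * (h + x - x)).
  by rewrite /GRing.scale /=; field.
rewrite normrM normfV ler_pdivrMl ?normr_gt0 // [`|h| * e]mulrC.
have {3}-> : h = h + x - x by ring.
apply: dP; last by rewrite addrK.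
move: hx hx1; rewrite !ltr_norml /= in_itv /= => /andP[? ?] /andP[? ?].
by apply/andP; split; lra.
Qed.

(** The mean value theorem integrates a bound on the derivative; one-sided
    derivatives at 0 and 1 suffice, as they give continuity there. *)
Lemma mvt_bound f g x y (C : R) k : has_derivative_on `[0, 1] f g ->
  0 <= x <= 1 -> 0 <= y <= 1 -> f x = 0 ->
  (forall t, 0 <= t <= 1 -> `|g t| <= C * `|t - x| ^+ k) ->
  `|f y| <= C * `|y - x| ^+ k.+1.
Proof.
move=> fg /andP[x0 x1] /andP[y0 y1] fx gC.
have fc := has_derivative_on_continuous fg.
have C0 t : 0 <= t <= 1 -> t != x -> 0 <= C.
  move=> t01 tx; have := le_trans (normr_ge0 _) (gC t t01).
  by rewrite pmulr_lge0 // exprn_gt0 // normr_gt0 subr_eq0.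
have mvt a b : 0 <= a -> b <= 1 -> a < b ->
    exists2 c, (a < c < b) & f b - f a = g c * (b - a).
  move=> a0 b1 ab.
  have [||c cab cE] := @MVT R f g a b ab.
  - move=> t; rewrite in_itv /= => /andP[at_ tb].
    apply: has_derivative_on_is_derive fg _.
    by rewrite (le_lt_trans a0 at_) (lt_le_trans tb b1).
  - apply: continuous_subspaceW fc => t /=; rewrite !in_itv /= => /andP[? ?].
    by apply/andP; split; lra.
  by exists c => //; move: cab; rewrite in_itv.
have [yx|xy|->] := ltgtP y x; last by rewrite fx normr0 subrr normr0 expr0n mulr0.
- have [c /andP[yc cx]] := mvt y x y0 x1 yx.
  rewrite fx sub0r => /eqP; rewrite eqr_oppLR => /eqP ->.
  have c01 : 0 <= c <= 1 by apply/andP; split; lra.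
  rewrite normrN normrM exprSr mulrA distrC ler_wpM2r //.
  apply: le_trans (gC c c01) _; rewrite ler_wpM2l ?(C0 y) ?y0 ?lt_eqF //.
  by rewrite lerXn2r ?nnegrE // !ltr0_norm ?subr_lt0 //; lra.
- have [c /andP[yc cx]] := mvt x y x0 y1 xy.
  rewrite fx subr0 => ->.
  have c01 : 0 <= c <= 1 by apply/andP; split; lra.
  rewrite normrM exprSr mulrA ler_wpM2r //.
  apply: le_trans (gC c c01) _; rewrite ler_wpM2l ?(C0 y) ?y0 ?gt_eqF //.
  by rewrite lerXn2r ?nnegrE // !gtr0_norm ?subr_gt0 //; lra.
Qed.

Lemma continuously_differentiable_on_continuous k f :
  continuously_differentiable_on `[0, 1] k f -> {within `[0, 1], continuous f}.
Proof. by case: k => [|k] //= [g [/has_derivative_on_continuous]]. Qed.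

Lemma has_derivative_on_poly A x n (c : nat -> R) :
  has_derivative_on A (fun t => \sum_(0 <= j < n) c j / j.+1%:R * (t - x) ^+ j.+1)
     (fun t => \sum_(0 <= j < n) c j * (t - x) ^+ j).
Proof.
move=> t At.
pose F (y : R) := \sum_(0 <= j < n) c j / j.+1%:R * (y - x) ^+ j.+1.
suff dF : is_derive t 1 F (\sum_(0 <= j < n) c j * (t - x) ^+ j).
  have [/cvg_ex [l Fl] dE] := dF.
  have lE : l = \sum_(0 <= j < n) c j * (t - x) ^+ j by rewrite -dE; apply/esym/cvg_lim.
  rewrite -lE; apply/cvgrPdist_lt => e e0.
  have /cvgrPdist_lt /(_ e e0) := Fl.
  rewrite /prop_near1 /dnbhs /within /= => /nbhs_ballP [d /= d0 dP].
  apply/nbhs_ballP; exists d => // y; rewrite /ball /= distrC => yd yt _.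
  have := dP (y - t); rewrite /ball /= sub0r normrN subr_eq0 => /(_ yd yt).
  by rewrite /GRing.scale /= mulr1 subrK mulrC.
rewrite /F; elim: n {F} => [|n IH].
  rewrite big_nil (_ : (fun _ => _) = cst 0); last first.
    by apply/funext => y; rewrite big_nil.
  exact: is_derive_cst.
rewrite big_nat_recr //=.
rewrite (_ : (fun _ => _) = (fun y => \sum_(0 <= j < n) c j / j.+1%:R * (y - x) ^+ j.+1)
    + (fun y => c n / n.+1%:R * (y - x) ^+ n.+1)); last first.
  by apply/funext => y; rewrite big_nat_recr.
apply: is_deriveD.
have dX : is_derive t 1 (fun y : R => (y - x) ^+ n.+1) (n.+1%:R * (t - x) ^+ n).
  have dI : is_derive t 1 (fun y : R => y - x) 1.
    by apply: is_derive_eq; rewrite oppr0 addr0.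
  have := is_deriveX n.+1 dI; rewrite /GRing.scale /= mulr1.
  by rewrite (_ : (fun y => y - x) ^+ n.+1 = fun y => (y - x) ^+ n.+1) // exprfctE.
have := @is_deriveZ _ _ _ _ (c n / n.+1%:R) t 1 _ dX.
rewrite /GRing.scale /= mulrA divfK ?pnatr_eq0 //.
Qed.

(** Induction on k: the expansion of the derivative integrates term by term, and
    [mvt_bound] integrates its remainder.  No formula for the coefficients is
    needed beyond the constant one. *)
Lemma taylor_bound k f x :
  continuously_differentiable_on `[0, 1] k f -> 0 <= x <= 1 ->
  exists (c : nat -> R) (C : R), ((0 < k)%N -> c 0%N = f x) /\
   forall t, 0 <= t <= 1 ->
   `|f t - \sum_(0 <= j < k) c j * (t - x) ^+ j| <= C * `|t - x| ^+ k.
Proof.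
move=> + x01; elim: k f => [|k IH] f /=.
  move=> fc; exists (fun=> 0).
  have [a _ fa] := EVT_max ler01 fc; have [b _ fb] := EVT_min ler01 fc.
  exists (`|f a| + `|f b|); split=> // t t01.
  have t01' : t \in `[0, 1] by rewrite in_itv.
  rewrite big_nil subr0 expr0 mulr1 ler_norml.
  have := fa t t01'; have := fb t t01'.
  have := ler_norm (f a); have := ler_norm (- f b); rewrite normrN.
  have := normr_ge0 (f a); have := normr_ge0 (f b).
  by move=> *; apply/andP; split; lra.
move=> [g [fg /IH [c [C [_ gC]]]]].
exists (fun j => if j is j'.+1 then c j' / j'.+1%:R else f x), C; split=> // t t01.
pose q y := \sum_(0 <= j < k) c j / j.+1%:R * (y - x) ^+ j.+1.
have dq := @has_derivative_on_poly `[0, 1] x k c.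
pose h y := f y - f x - q y.
have dh : has_derivative_on `[0, 1] h (fun y => g y - \sum_(0 <= j < k) c j * (y - x) ^+ j).
  move=> y y01.
  rewrite (_ : (fun z => (h z - h y) / (z - y)) =
    (fun z => (f z - f y) / (z - y)) \- (fun z => (q z - q y) / (z - y))).
    exact: cvgB (fg y y01) (dq y y01).
  by apply/funext => z; rewrite /h /= -mulrBl; congr (_ / _); ring.
have hx : h x = 0.
  by rewrite /h subrr sub0r /q big1 ?oppr0 // => j _; rewrite subrr expr0n mulr0.
rewrite big_nat_recl //= expr0 mulr1 opprD addrA.
exact: mvt_bound dh x01 t01 hx gC.
Qed.
End Taylor.

(** * Binomial and alpha-Bernstein averages *)

Section Means.
Context {R : realType}.
Implicit Types (x al : R) (g h : nat -> R) (N k : nat).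

Definition fdiff g k := g k.+1 - g k.

(** The Bernstein operator of degree N at x, applied to a function of the index k
    itself.  In the recursive form of de Casteljau, linearity, positivity and
    Stein's identity are inductions without binomial coefficients. *)
Fixpoint bernstein_mean x N g : R :=
  if N is N'.+1 then
    (1 - x) * bernstein_mean x N' g
    + x * bernstein_mean x N' (fun k => g k.+1)
  else g 0%N.

(** Two further trials added to k successes: with weight al they are independent,
    with weight 1 - al the second repeats the first. *)
Definition mix_step x al g k :=
  (1 - al) * ((1 - x) * g k + x * g k.+2)
  + al * ((1 - x) ^+ 2 * g k + 2 * x * (1 - x) * g k.+1 + x ^+ 2 * g k.+2).

Definition alpha_mean x al N g := bernstein_mean x N (mix_step x al g).

Lemma eq_bernstein_mean x N g h :
  (forall k, (k <= N)%N -> g k = h k) ->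
  bernstein_mean x N g = bernstein_mean x N h.
Proof.
elim: N g h => [|N IH] g h gh /=; first exact: gh.
congr (_ * _ + _ * _); apply: IH => k kN; apply: gh => //; exact: leqW.
Qed.

Lemma bernstein_meanD x N g h :
  bernstein_mean x N (fun k => g k + h k)
  = bernstein_mean x N g + bernstein_mean x N h.
Proof. by elim: N g h => [|N IH] g h //=; rewrite !IH; ring. Qed.

Lemma bernstein_meanZ x N c g :
  bernstein_mean x N (fun k => c * g k) = c * bernstein_mean x N g.
Proof. by elim: N g => [|N IH] g //=; rewrite !IH; ring. Qed.

Lemma bernstein_mean_cst x N c : bernstein_mean x N (fun=> c) = c.
Proof. by elim: N => [|N IH] //=; rewrite !IH; ring. Qed.

Lemma bernstein_mean_ge0 x N g : 0 <= x <= 1 ->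
  (forall k, (k <= N)%N -> 0 <= g k) -> 0 <= bernstein_mean x N g.
Proof.
move=> /andP[x0 x1].
elim: N g => [|N IH] g g0 /=; first exact: g0.
rewrite addr_ge0 ?mulr_ge0 ?subr_ge0 ?IH // => k kN; rewrite g0 //.
exact: leqW.
Qed.

Lemma bernstein_meanE x N g :
  bernstein_mean x N g
  = \sum_(0 <= k < N.+1) 'C(N, k)%:R * (x ^+ k * (1 - x) ^+ (N - k)) * g k.
Proof.
elim: N g => [|N IH] g; first by rewrite big_nat1 bin0 !expr0 !mul1r.
rewrite /= !IH !mulr_sumr.
rewrite [RHS](big_nat_recl _ _ _ (leq0n N.+1)).
under [in RHS]eq_bigr => k _ do
  rewrite binS natrD !mulrDl subSS.
rewrite big_split /= [in RHS]addrA; congr (_ + _); last first.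
  by apply: eq_bigr => k _; rewrite exprS; ring.
rewrite (big_nat_recl _ _ _ (leq0n N)) [in RHS]big_nat_recr //=.
rewrite (bin_small (ltnSn N)) !mul0r addr0 !bin0 !subn0; congr (_ + _).
  by rewrite exprS; ring.
rewrite !big_nat; apply: eq_bigr => k /andP[_ kN].
by rewrite -(subnSK kN) [(1 - x) ^+ _.+1 in RHS]exprS; ring.
Qed.

(** Stein's identity for the binomial law: a factor k - N x is traded for a
    difference and a factor N, up to a term of lower weight. *)
Lemma bernstein_mean_center x N g :
  bernstein_mean x N (fun k => (k%:R - N%:R * x) * g k)
  = N%:R * (x * (1 - x)) * bernstein_mean x N (fdiff g)
    - x * bernstein_mean x N (fun k => (k%:R - N%:R * x) * fdiff g k).
Proof.
elim: N g => [|N IH] g /=; first by rewrite /fdiff; ring.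
have split_mean c h : bernstein_mean x N (fun k => (k%:R - N%:R * x + c) * h k)
  = bernstein_mean x N (fun k => (k%:R - N%:R * x) * h k)
    + c * bernstein_mean x N h.
  by rewrite -bernstein_meanZ -bernstein_meanD; congr bernstein_mean;
    apply/funext => k; ring.
have lo h : bernstein_mean x N (fun k => (k%:R - N.+1%:R * x) * h k)
  = bernstein_mean x N (fun k => (k%:R - N%:R * x) * h k)
    + (- x) * bernstein_mean x N h.
  rewrite -split_mean; congr bernstein_mean; apply/funext => k.
  by rewrite -[N.+1]addn1 natrD; ring.
have hi h : bernstein_mean x N (fun k => (k.+1%:R - N.+1%:R * x) * h k)
  = bernstein_mean x N (fun k => (k%:R - N%:R * x) * h k)
    + (1 - x) * bernstein_mean x N h.
  rewrite -split_mean; congr bernstein_mean; apply/funext => k.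
  by rewrite -[N.+1]addn1 -[k.+1]addn1 !natrD; ring.
rewrite !lo (hi (fun k => g k.+1)) (hi (fun k => fdiff g k.+1)).
rewrite (IH g) (IH (fun k => g k.+1)).
have dE : bernstein_mean x N (fdiff g)
  = bernstein_mean x N (fun k => g k.+1) + (-1) * bernstein_mean x N g.
  rewrite -bernstein_meanZ -bernstein_meanD; congr bernstein_mean.
  by apply/funext => k; rewrite /fdiff; ring.
rewrite -[N.+1]addn1 natrD.
set a := bernstein_mean x N (fun k => _ * fdiff g k).
set b := bernstein_mean x N (fdiff g) in dE *.
rewrite (_ : fdiff (fun k => g k.+1) = fun k => fdiff g k.+1) //.
have -> : bernstein_mean x N (fun k => g k.+1) = b + bernstein_mean x N g.
  by rewrite dE; ring.
ring.
Qed.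

End Means.

Section AlphaMean.
Context {R : realType}.
Implicit Types (x al : R) (g h : nat -> R) (N k : nat).

Lemma bernstein_mean2 x N g :
  bernstein_mean x N.+2 g
  = bernstein_mean x N (fun k => (1 - x) ^+ 2 * g k + 2 * x * (1 - x) * g k.+1
                                + x ^+ 2 * g k.+2).
Proof. by rewrite !bernstein_meanD !bernstein_meanZ /=; ring. Qed.

Lemma alpha_meanE x al N g :
  alpha_mean x al N g
  = \sum_(0 <= k < N.+3) alpha_bernstein al N.+2 k x * g k.
Proof.
have -> : alpha_mean x al N g
  = (1 - al) * ((1 - x) * bernstein_mean x N g
                + x * bernstein_mean x N (fun k => g k.+2))
    + al * bernstein_mean x N.+2 g.
  rewrite /alpha_mean /mix_step bernstein_meanD !bernstein_meanZ bernstein_meanD.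
  by rewrite !bernstein_meanZ -bernstein_mean2.
rewrite !bernstein_meanE /alpha_bernstein.
transitivity (\sum_(0 <= k < N.+3)
  ((1 - al) * ((1 - x) * ('C(N, k)%:R * (x ^+ k * (1 - x) ^+ (N - k)) * g k))
  + (1 - al) * (x * ((if (2 <= k)%N then 'C(N, k - 2)%:R else 0)
       * (x ^+ (k - 2) * (1 - x) ^+ (N.+2 - k)) * g k))
  + al * ('C(N.+2, k)%:R * (x ^+ k * (1 - x) ^+ (N.+2 - k)) * g k))); last first.
  rewrite !big_nat; apply: eq_bigr => k /andP[_ kN].
  rewrite [in RHS](_ : (N.+2 - k - 1 = N.+1 - k)%N); last by lia.
  have -> : 'C(N, k)%:R * (1 - al) * (x ^+ k * (1 - x) ^+ (N.+1 - k)) =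
      'C(N, k)%:R * (1 - al) * ((1 - x) * (x ^+ k * (1 - x) ^+ (N - k))) :> R.
    have [kN'|kN'] := leqP k N; last by rewrite bin_small // !mul0r.
    by rewrite (subSn kN') [in LHS]exprS; ring.
  case: k {kN} => [|[|k]] /=; [ring | ring |].
  by rewrite !subSS !subn0 [x ^+ k.+1 in RHS]exprS; ring.
rewrite !big_split /= -!mulr_sumr mulrDr; congr (_ * (_ * _) + _ * (_ * _) + _ * _).
- rewrite [RHS](big_nat_recr N.+2) // (big_nat_recr N.+1) //=.
  by rewrite !(bin_small (ltnSn _), bin_small (leqW (ltnSn _))) !mul0r !addr0.
- rewrite [RHS]big_nat_recl // [in RHS]big_nat_recl //= !mul0r !add0r.
  by apply: eq_bigr => k _; rewrite !subSS !subn0.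
Qed.

Lemma alpha_bernstein_small x al m k :
  (1 < m)%N -> (m < k)%N -> alpha_bernstein al m k x = 0.
Proof.
case: m k => [|[|m]] // [|[|k]] //= _; rewrite !ltnS => mk.
rewrite !subSS subn0 (bin_small mk) (@bin_small m k.+2) ?(leqW (leqW mk)) //.
by rewrite (@bin_small m.+2 k.+2) // !mul0r !addr0.
Qed.

(** The basis functions vanish outside 0..N+2 and the sum reaches N + 6, so shifting
    the index by at most 4 leaves no boundary term. *)
Lemma sum_alpha_bernstein_shift x al N i g : (i <= 4)%N ->
  \sum_(0 <= k < N.+4.+3) alpha_bernstein_shift al N.+2 k i x * g k
  = alpha_mean x al N (fun k => g (k + i)%N).
Proof.
move=> i4.
rewrite (big_cat_nat (n := i)) //=; last by rewrite ltnW // (leq_ltn_trans i4).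
rewrite [X in X + _]big_nat big1 ?add0r; last first.
  by move=> k /andP[_ ki]; rewrite /alpha_bernstein_shift leqNgt ki mul0r.
rewrite -{1}[i]add0n big_addn alpha_meanE.
have le3 : (N.+3 <= N.+4.+3 - i)%N.
  rewrite leq_subRL; last by rewrite (leq_trans i4).
  by rewrite -[N.+4.+3]/(4 + N.+3)%N leq_add2r.
rewrite (big_cat_nat (n := N.+3)) //=.
rewrite [X in _ + X]big_nat [X in _ + X]big1 ?addr0; last first.
  move=> k /andP[kN _].
  by rewrite /alpha_bernstein_shift leq_addl addnK alpha_bernstein_small ?mul0r.
by apply: eq_bigr => k _; rewrite /alpha_bernstein_shift leq_addl addnK.
Qed.

Lemma alpha_meanD x al N g h :
  alpha_mean x al N (fun k => g k + h k)
  = alpha_mean x al N g + alpha_mean x al N h.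
Proof.
rewrite /alpha_mean -bernstein_meanD; congr bernstein_mean.
by apply/funext => k; rewrite /mix_step; ring.
Qed.

Lemma alpha_meanZ x al N c g :
  alpha_mean x al N (fun k => c * g k) = c * alpha_mean x al N g.
Proof.
rewrite /alpha_mean -bernstein_meanZ; congr bernstein_mean.
by apply/funext => k; rewrite /mix_step; ring.
Qed.

Lemma eq_alpha_mean x al N g h :
  (forall k, (k <= N.+2)%N -> g k = h k) -> alpha_mean x al N g = alpha_mean x al N h.
Proof.
move=> gh; apply: eq_bernstein_mean => k kN.
by rewrite /mix_step (gh k (leqW (leqW kN))) (gh k.+1 (leqW kN)) (gh k.+2 kN).
Qed.

Lemma alpha_mean_ge0 x al N g : 0 <= x <= 1 -> 0 <= al <= 1 ->
  (forall k, (k <= N.+2)%N -> 0 <= g k) -> 0 <= alpha_mean x al N g.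
Proof.
move=> x01 /andP[al0 al1] g0; apply: bernstein_mean_ge0 => // k kN.
have /andP[x0 x1] := x01.
have G0 : 0 <= g k := g0 k (leqW (leqW kN)).
have G1 : 0 <= g k.+1 := g0 k.+1 (leqW kN).
have G2 : 0 <= g k.+2 := g0 k.+2 kN.
have x1' : 0 <= 1 - x by rewrite subr_ge0.
have al1' : 0 <= 1 - al by rewrite subr_ge0.
by rewrite /mix_step; repeat (assumption || exact: ler0n || apply: addr_ge0
  || apply: mulr_ge0 || apply: exprn_ge0).
Qed.

Lemma alpha_mean_norm_le x al N g h : 0 <= x <= 1 -> 0 <= al <= 1 ->
  (forall k, (k <= N.+2)%N -> `|g k| <= h k) ->
  `|alpha_mean x al N g| <= alpha_mean x al N h.
Proof.
move=> x01 al01 gh.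
have sum_ge0 c : (c = 1 \/ c = - 1) -> 0 <= alpha_mean x al N h + c * alpha_mean x al N g.
  move=> c1; rewrite -alpha_meanZ -alpha_meanD; apply: alpha_mean_ge0 => // k kN.
  by have := gh k kN; rewrite ler_norml => /andP[? ?]; case: c1 => ->; lra.
have := sum_ge0 1 (or_introl erefl); have := sum_ge0 (-1) (or_intror erefl).
by rewrite ler_norml => ? ?; apply/andP; split; lra.
Qed.

End AlphaMean.

(** * Weighted polynomials and the size of their averages *)

Section Growth.
Context {R : realType}.
Implicit Types (u v : nat -> R).

(** Sizes are compared with n = N + 6, which never vanishes. *)
Definition poly_growth d u :=
  exists C : R, forall N, `|u N| <= C * (N + 6)%:R ^+ d.

Lemma poly_growth_cst c : poly_growth 0 (fun=> c).
Proof. by exists `|c| => N; rewrite expr0 mulr1. Qed.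

Lemma poly_growth_degree : poly_growth 1 (fun N => (N + 6)%:R).
Proof. by exists 1 => N; rewrite mul1r expr1 ger0_norm. Qed.

Lemma poly_growthD d u v :
  poly_growth d u -> poly_growth d v -> poly_growth d (fun N => u N + v N).
Proof.
move=> [C uC] [D vD]; exists (C + D) => N.
by rewrite mulrDl (le_trans (ler_normD _ _)) // lerD.
Qed.

Lemma poly_growthM d e u v :
  poly_growth d u -> poly_growth e v -> poly_growth (d + e) (fun N => u N * v N).
Proof.
move=> [C uC] [D vD]; exists (C * D) => N.
by rewrite normrM exprD mulrACA ler_pM.
Qed.

Lemma poly_growthZ d c u : poly_growth d u -> poly_growth d (fun N => c * u N).
Proof. by move=> ud; rewrite -[d]add0n; apply: poly_growthM (poly_growth_cst c) ud. Qed.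

Lemma poly_growth_le d u v :
  (forall N, `|u N| <= `|v N|) -> poly_growth d v -> poly_growth d u.
Proof. by move=> uv [C vC]; exists C => N; apply: le_trans (uv N) (vC N). Qed.

Lemma poly_growth_mono d e u : (d <= e)%N -> poly_growth d u -> poly_growth e u.
Proof.
move=> de [C uC]; exists C => N; apply: le_trans (uC N) _.
have C0 : 0 <= C.
  have := le_trans (normr_ge0 _) (uC N).
  by rewrite pmulr_lge0 // exprn_gt0 // ltr0n addn_gt0 orbT.
by rewrite ler_wpM2l // ler_weXn2l // ler1n addn_gt0 orbT.
Qed.

End Growth.

Section Graded.
Context {R : realType} (x : R).
Implicit Types (g h : nat -> nat -> R).

(** The index k measured from (N + 2) x, its mean under the alpha-Bernstein law
    of order N + 2. *)
Definition center N k : R := k%:R - (N%:R + 2) * x.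

(** Polynomials of weight less than w, where k - (N + 2) x has weight 1 and n has
    weight 2.  With a strict bound, grade 0 holds zero only; so a difference
    always lands in the grade w.-1, also where the predecessor is truncated. *)
Inductive graded : nat -> (nat -> nat -> R) -> Prop :=
| graded_zero w : graded w (fun _ _ => 0)
| graded_cst w c : graded w.+1 (fun _ _ => c)
| graded_center w g : graded w.-1 g -> graded w (fun N k => center N k * g N k)
| graded_degree w g : graded w.-2 g -> graded w (fun N k => (N + 6)%:R * g N k)
| graded_add w g h : graded w g -> graded w h ->
    graded w (fun N k => g N k + h N k).

Lemma eq_graded w g h :
  graded w g -> (forall N k, g N k = h N k) -> graded w h.
Proof. by move=> + gh; rewrite (_ : g = h) //; apply/funext => N; apply/funext. Qed.

Lemma graded0_eq0 g N k : graded 0 g -> g N k = 0.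
Proof.
move eq_w: 0%N => w gw; elim: gw eq_w => {w g} //.
- by move=> w g _ IH w0; rewrite IH ?mulr0 // -w0.
- by move=> w g _ IH w0; rewrite IH ?mulr0 // -w0.
- by move=> w g h _ IHg _ IHh w0; rewrite IHg // IHh // addr0.
Qed.

Lemma graded_mono w v g : (w <= v)%N -> graded w g -> graded v g.
Proof.
move=> + gw; elim: gw v => {w g}.
- by move=> *; apply: graded_zero.
- by move=> w c [|v] // _; apply: graded_cst.
- by move=> w g _ IH v wv; apply/graded_center/IH; rewrite -!subn1 leq_sub2r.
- by move=> w g _ IH v wv; apply/graded_degree/IH; rewrite -!subn2 leq_sub2r.
- by move=> w g h _ IHg _ IHh v wv; apply: graded_add; [apply: IHg|apply: IHh].
Qed.

Lemma graded_scale w c g : graded w g -> graded w (fun N k => c * g N k).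
Proof.
elim=> {w g}.
- by move=> w; apply: (eq_graded (graded_zero w)) => N k; rewrite mulr0.
- by move=> w d; apply: graded_cst.
- by move=> w g _ /graded_center gw; apply: (eq_graded gw) => N k; ring.
- by move=> w g _ /graded_degree gw; apply: (eq_graded gw) => N k; ring.
- move=> w g h _ IHg _ IHh; apply: (eq_graded (graded_add IHg IHh)) => N k; ring.
Qed.

Lemma graded_fdiff w g : graded w g -> graded w.-1 (fun N => fdiff (g N)).
Proof.
elim=> {w g}.
- by move=> w; apply: (eq_graded (graded_zero _)) => N k; rewrite /fdiff subr0.
- by move=> w c; apply: (eq_graded (graded_zero _)) => N k; rewrite /fdiff subrr.
- move=> w g gw IH.
  have IH' := graded_mono (leq_pred _) IH.
  apply: (eq_graded (graded_add (graded_center IH) (graded_add gw IH'))) => N k.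
  by rewrite /fdiff /center -[k.+1]addn1 natrD; ring.
- move=> w g _ IH; apply: (eq_graded (graded_degree (w := w.-1) IH)) => N k.
  by rewrite /fdiff; ring.
- move=> w g h _ IHg _ IHh; apply: (eq_graded (graded_add IHg IHh)) => N k.
  by rewrite /fdiff; ring.
Qed.

Lemma graded_shift w g : graded w g -> graded w (fun N k => g N k.+1).
Proof.
move=> gw; have dg := graded_mono (leq_pred _) (graded_fdiff gw).
apply: (eq_graded (graded_add gw dg)) => N k.
by rewrite /fdiff; ring.
Qed.

Lemma graded_mix_step al w g : graded w g ->
  graded w (fun N => mix_step x al (g N)).
Proof.
move=> g0; have g1 := graded_shift g0; have g2 := graded_shift g1.
have H := graded_add (graded_scale ((1 - al) * (1 - x) + al * (1 - x) ^+ 2) g0)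
  (graded_add (graded_scale (al * (2 * x * (1 - x))) g1)
              (graded_scale ((1 - al) * x + al * x ^+ 2) g2)).
by apply: (eq_graded H) => N k; rewrite /mix_step; ring.
Qed.

(** By Stein's identity the average of center * g is n times that of the
    difference of g, which has two units of weight less than center * g, plus
    averages of lower weight.  So a factor n appears once for every two units of
    weight, and an odd unit is lost: hence the half. *)
Lemma bernstein_mean_growth w g : graded w g ->
  poly_growth w.-1./2 (fun N => bernstein_mean x N (g N)).
Proof.
have zero d u : (forall N k, u N k = 0) ->
    poly_growth d (fun N => bernstein_mean x N (u N)).
  move=> u0; apply: poly_growth_mono (leq0n d) _; exists 0 => N.
  by rewrite (_ : u N = fun=> 0) ?bernstein_mean_cst ?normr0 ?mul0r //; apply/funext.
have [W] := ubnP w; elim: W w g => // W IHW w g wW gw.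
elim: gw wW => {w g}.
- by move=> w _; apply: zero.
- move=> w c _; apply: poly_growth_mono (leq0n _) _; exists `|c| => N.
  by rewrite bernstein_mean_cst expr0 mulr1.
- move=> [|[|w]] g gw _ wW; first by apply: zero => N k; rewrite (graded0_eq0 _ _ gw) mulr0.
    by apply: zero => N k; rewrite (graded0_eq0 _ _ gw) mulr0.
  have dg := graded_fdiff gw.
  have -> : (fun N => bernstein_mean x N (fun k => center N k * g N k)) =
    (fun N => N%:R * (x * (1 - x) * bernstein_mean x N (fdiff (g N)))
       + (- x * bernstein_mean x N (fun k => center N k * fdiff (g N) k + 2 * x * fdiff (g N) k)
       + - (2 * x) * bernstein_mean x N (g N))).
    apply/funext => N.
    have -> : (fun k => center N k * g N k)
       = fun k => (k%:R - N%:R * x) * g N k + - (2 * x) * g N k.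
      by apply/funext => k; rewrite /center; ring.
    rewrite bernstein_meanD bernstein_mean_center bernstein_meanZ.
    have -> : (fun k => center N k * fdiff (g N) k + 2 * x * fdiff (g N) k)
       = fun k => (k%:R - N%:R * x) * fdiff (g N) k.
      by apply/funext => k; rewrite /center; ring.
    by ring.
  apply: poly_growthD; last first.
    apply: poly_growthD; apply: poly_growthZ.
      apply: (poly_growth_mono (d := w./2)); first by rewrite half_leq.
      apply: (IHW w.+1) => //.
      apply: graded_add (graded_center (w := w.+1) dg) (graded_scale _ _).
      exact: graded_mono (leqnSn _) dg.
    by apply: (poly_growth_mono (d := w./2)); [rewrite half_leq|apply: (IHW w.+1)].
  (* For w = 0 the difference vanishes, and so does the term with factor N. *)
  case: w gw wW dg => [|w] gw wW dg.
    exists 0 => N; rewrite mul0r normr_le0 (_ : fdiff _ = fun=> 0).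
      by rewrite bernstein_mean_cst !mulr0.
    by apply/funext => k; apply: graded0_eq0 dg.
  rewrite -[_./2]/(1 + w./2)%N; apply: poly_growthM.
    apply: poly_growth_le poly_growth_degree => N.
    by rewrite !ger0_norm // ler_nat leq_addr.
  apply: poly_growthZ; apply: (IHW w.+1) => //.
  by rewrite ltnW // ltnW.
- move=> [|[|w]] g gw _ wW.
  + by apply: zero => N k; rewrite (graded0_eq0 _ _ gw) mulr0.
  + by apply: zero => N k; rewrite (graded0_eq0 _ _ gw) mulr0.
  case: w gw wW => [|w] gw wW; first by apply: zero => N k; rewrite (graded0_eq0 _ _ gw) mulr0.
  rewrite (_ : (fun N => _) = fun N => (N + 6)%:R * bernstein_mean x N (g N)); last first.
    by apply/funext => N; rewrite bernstein_meanZ.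
  rewrite -[_./2]/(1 + w./2)%N; apply: poly_growthM poly_growth_degree _.
  by apply: (IHW w.+1) => //; rewrite ltnW.
- move=> w g h _ IHg _ IHh wW.
  rewrite (_ : (fun N => _) = fun N => bernstein_mean x N (g N) + bernstein_mean x N (h N)).
    by apply: poly_growthD; [apply: IHg|apply: IHh].
  by apply/funext => N; rewrite bernstein_meanD.
Qed.

Lemma alpha_mean_growth al w g : graded w g ->
  poly_growth w.-1./2 (fun N => alpha_mean x al N (g N)).
Proof. by move=> /(graded_mix_step al)/bernstein_mean_growth. Qed.

End Graded.

(** * Central moments of the alpha-Bernstein average *)

Section Moments.
Context {R : realType}.
Implicit Types (x al rho s : R).

(** The binomial central moments up to order four, recentred by y so that the
    three shifts of [mix_step] can be treated alike. *)
Lemma bernstein_mean_quartic x N y p0 p1 p2 p3 p4 :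
  let w k : R := k%:R - N%:R * x + y in
  bernstein_mean x N
    (fun k => p0 + p1 * w k + p2 * w k ^+ 2 + p3 * w k ^+ 3 + p4 * w k ^+ 4)
  = p0 + p1 * y + p2 * y ^+ 2 + p3 * y ^+ 3 + p4 * y ^+ 4
    + (p2 + 3 * p3 * y + 6 * p4 * y ^+ 2) * (N%:R * (x * (1 - x)))
    + (p3 + 4 * p4 * y) * (N%:R * (x * (1 - x)) * (1 - 2 * x))
    + p4 * (3 * N%:R ^+ 2 * (x * (1 - x)) ^+ 2
            + N%:R * (x * (1 - x)) * (1 - 6 * (x * (1 - x)))).
Proof.
move=> w; pose c k : R := k%:R - N%:R * x.
have cS k : c k.+1 = c k + 1 by rewrite /c -[k.+1]addn1 natrD; ring.
pose E := bernstein_mean x N.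
have step f : E (fun k => c k * f k)
    = N%:R * (x * (1 - x)) * E (fdiff f) - x * E (fun k => c k * fdiff f k).
  exact: bernstein_mean_center.
have E0 a : E (fun=> a) = a by exact: bernstein_mean_cst.
have poly3 a0 a1 a2 a3 :
    E (fun k => a0 + a1 * c k + a2 * c k ^+ 2 + a3 * c k ^+ 3)
    = a0 + a1 * E (fun k => c k * 1) + a2 * E (fun k => c k * c k)
      + a3 * E (fun k => c k * c k ^+ 2).
  rewrite -[X in _ = X + _ + _ + _]E0 /E -!bernstein_meanZ -!bernstein_meanD.
  by congr bernstein_mean; apply/funext => k; ring.
have E1 : E (fun k => c k * 1) = 0.
  rewrite step (_ : fdiff _ = fun=> 0); last by apply/funext => k; rewrite /fdiff; ring.
  rewrite (_ : (fun k => _) = fun=> 0); last by apply/funext => k; ring.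
  by rewrite E0; ring.
have E2 : E (fun k => c k * c k) = N%:R * (x * (1 - x)).
  rewrite step (_ : fdiff _ = fun=> 1); last by apply/funext => k; rewrite /fdiff cS; ring.
  by rewrite E0 E1; ring.
have E3 : E (fun k => c k * c k ^+ 2) = N%:R * (x * (1 - x)) * (1 - 2 * x).
  rewrite step (_ : fdiff _ = fun k => 1 + 2 * c k + 0 * c k ^+ 2 + 0 * c k ^+ 3); last first.
    by apply/funext => k; rewrite /fdiff cS; ring.
  rewrite (_ : (fun k => c k * _) = fun k => 0 + 1 * c k + 2 * c k ^+ 2 + 0 * c k ^+ 3); last first.
    by apply/funext => k; ring.
  by rewrite !poly3 E1 E2; ring.
have E4 : E (fun k => c k * c k ^+ 3) = 3 * N%:R ^+ 2 * (x * (1 - x)) ^+ 2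
            + N%:R * (x * (1 - x)) * (1 - 6 * (x * (1 - x))).
  rewrite step (_ : fdiff _ = fun k => 1 + 3 * c k + 3 * c k ^+ 2 + 0 * c k ^+ 3); last first.
    by apply/funext => k; rewrite /fdiff cS; ring.
  rewrite (_ : (fun k => c k * _) = fun k => 0 + 1 * c k + 3 * c k ^+ 2 + 3 * c k ^+ 3); last first.
    by apply/funext => k; ring.
  by rewrite !poly3 E1 E2 E3; ring.
transitivity (E (fun k =>
    ((p0 + p1 * y + p2 * y ^+ 2 + p3 * y ^+ 3 + p4 * y ^+ 4)
    + (p1 + 2 * p2 * y + 3 * p3 * y ^+ 2 + 4 * p4 * y ^+ 3) * c k
    + (p2 + 3 * p3 * y + 6 * p4 * y ^+ 2) * c k ^+ 2
    + (p3 + 4 * p4 * y) * c k ^+ 3) + p4 * (c k * c k ^+ 3))).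
  by congr bernstein_mean; apply/funext => k; rewrite /w -/(c k); ring.
by rewrite /E bernstein_meanD bernstein_meanZ -/E poly3 E1 E2 E3 E4; ring.
Qed.

(** Central moments of orders two, three and four of the alpha-Bernstein law of
    order n - 4.  The binomial part has n - 6 trials, and the two trials of
    [mix_step] have covariance (1 - al) x (1 - x). *)
Definition alpha_var x al (n : R) := x * (1 - x) * (n - 2 - 2 * al).
Definition alpha_third x al (n : R) := x * (1 - x) * (1 - 2 * x) * (n + 2 - 6 * al).
Definition alpha_fourth x al (n : R) :=
  3 * (n - 6) ^+ 2 * (x * (1 - x)) ^+ 2
  + (n - 6) * (x * (1 - x)) * (1 - 6 * (x * (1 - x)) + 12 * (2 - al) * (x * (1 - x)))
  + (1 - al) * (16 * (x * (1 - x)) * (1 - 3 * (x * (1 - x)))) + 2 * al * (x * (1 - x)).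

Lemma alpha_mean_quartic x al N p0 p1 p2 p3 p4 :
  let z k := center x N k in
  alpha_mean x al N
    (fun k => p0 + p1 * z k + p2 * z k ^+ 2 + p3 * z k ^+ 3 + p4 * z k ^+ 4)
  = p0 + p2 * alpha_var x al (N + 6)%:R + p3 * alpha_third x al (N + 6)%:R
    + p4 * alpha_fourth x al (N + 6)%:R.
Proof.
move=> z.
pose q k y := let w : R := k%:R - N%:R * x + y in
  p0 + p1 * w + p2 * w ^+ 2 + p3 * w ^+ 3 + p4 * w ^+ 4.
have z0 k : z k = k%:R - N%:R * x - 2 * x by rewrite /z /center; ring.
have zS k : z k.+1 = z k + 1.
  by rewrite /z /center -[k.+1]addn1 natrD; ring.
rewrite /alpha_mean.
rewrite (_ : mix_step _ _ _ = fun k =>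
    ((1 - al) * (1 - x) + al * (1 - x) ^+ 2) * q k (- (2 * x))
    + al * (2 * x * (1 - x)) * q k (1 - 2 * x)
    + ((1 - al) * x + al * x ^+ 2) * q k (2 - 2 * x)); last first.
  by apply/funext => k; rewrite /mix_step /q !zS z0; ring.
rewrite !bernstein_meanD !bernstein_meanZ /q !bernstein_mean_quartic.
rewrite /alpha_var /alpha_third /alpha_fourth natrD; ring.
Qed.

Definition newton (c1 c2 c3 c4 : R) (g : nat -> R) k :=
  g k + c1 * fdiff g k + c2 * fdiff (fdiff g) k
  + c3 * fdiff (fdiff (fdiff g)) k + c4 * fdiff (fdiff (fdiff (fdiff g))) k.

Lemma alpha_mean_newton_quartic x al N c1 c2 c3 c4 p0 p1 p2 p3 p4 :
  let z k := center x N k in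
  let n := (N + 6)%:R in
  alpha_mean x al N (newton c1 c2 c3 c4
    (fun k => p0 + p1 * z k + p2 * z k ^+ 2 + p3 * z k ^+ 3 + p4 * z k ^+ 4))
  = p0 + p2 * alpha_var x al n + p3 * alpha_third x al n + p4 * alpha_fourth x al n
    + c1 * (p1 + p2 + p3 * (3 * alpha_var x al n + 1)
            + p4 * (4 * alpha_third x al n + 6 * alpha_var x al n + 1))
    + c2 * (2 * p2 + 6 * p3 + p4 * (12 * alpha_var x al n + 14))
    + c3 * (6 * p3 + 36 * p4) + 24 * c4 * p4.
Proof.
move=> z n.
have zS k : z k.+1 = z k + 1.
  by rewrite /z /center -[k.+1]addn1 natrD; ring.
rewrite (_ : newton _ _ _ _ _ = fun k =>
  (p0 + c1 * (p1 + p2 + p3 + p4) + c2 * (2 * p2 + 6 * p3 + 14 * p4)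
     + c3 * (6 * p3 + 36 * p4) + 24 * c4 * p4)
  + (p1 + c1 * (2 * p2 + 3 * p3 + 4 * p4) + c2 * (6 * p3 + 24 * p4) + 24 * c3 * p4) * z k
  + (p2 + c1 * (3 * p3 + 6 * p4) + 12 * c2 * p4) * z k ^+ 2
  + (p3 + 4 * c1 * p4) * z k ^+ 3 + p4 * z k ^+ 4).
  by rewrite alpha_mean_quartic /n; ring.
by apply/funext => k; rewrite /newton /fdiff !zS; ring.
Qed.

End Moments.

(** * Moments of the Beta densities *)

Section BetaNumerators.
Context {R : realType}.
Implicit Types (x rho : R).

(** For T of Beta law with parameters a and s - a, the mean of (T - x)^j is
    [beta_num a s x j] over the rising factorial of s of order j; see
    [beta_momentE]. *)
Fixpoint beta_num (a s x : R) j : R :=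
  if j is j'.+1 then
    if j' is j''.+1 then
      (a - s * x + j'%:R * (1 - 2 * x)) * beta_num a s x j'
      + j'%:R * (x * (1 - x)) * (s + j''%:R) * beta_num a s x j''
    else a - s * x
  else 1.

Lemma beta_numSS (a s x : R) j :
  beta_num a s x j.+2
  = (a - s * x + j.+1%:R * (1 - 2 * x)) * beta_num a s x j.+1
    + j.+1%:R * (x * (1 - x)) * (s + j%:R) * beta_num a s x j.
Proof. by []. Qed.

Definition paltanea_num rho x j N k :=
  beta_num (k%:R * rho + 1) ((N + 6)%:R * rho + 2) x j.

(** Value at k = (N + 2) x of the first numerator; see [paltanea_center]. *)
Definition bias x rho : R := 1 - 2 * x - 4 * x * rho.

Lemma paltanea_center rho x N k :
  k%:R * rho + 1 - ((N + 6)%:R * rho + 2) * x = rho * center x N k + bias x rho.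
Proof. by rewrite /bias /center natrD; ring. Qed.

(** In the recursion each factor a - s x = rho * center + bias has weight 1 and each
    factor s has weight 2 but skips one index, so the weight grows by one per
    step. *)
Lemma graded_paltanea_num rho x j : graded x j.+1 (paltanea_num rho x j).
Proof.
suff: graded x j.+1 (paltanea_num rho x j) /\ graded x j.+2 (paltanea_num rho x j.+1).
  by case.
elim: j => [|j [IH0 IH1]]; split => //.
- by apply: (eq_graded (graded_cst x 0 1)).
- apply: (eq_graded (graded_add (graded_scale rho (graded_center (w := 2) (graded_cst x 0 1)))
    (graded_cst x 1 (bias x rho)))) => N k.
  by rewrite /paltanea_num [RHS]paltanea_center; ring.
- have Hz := graded_scale rho (graded_center (w := j.+3) IH1).
  have Hc := graded_scale (bias x rho + j.+1%:R * (1 - 2 * x)) (graded_mono (leqnSn _) IH1).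
  have Hs := graded_scale (rho * (j.+1%:R * (x * (1 - x)))) (graded_degree (w := j.+3) IH0).
  have Hd := graded_scale ((2 + j%:R) * (j.+1%:R * (x * (1 - x))))
    (graded_mono (leq_trans (leqnSn _) (leqnSn _)) IH0).
  apply: (eq_graded (graded_add (graded_add Hz Hc) (graded_add Hs Hd))) => N k.
  by rewrite /paltanea_num [RHS]beta_numSS paltanea_center; ring.
Qed.

End BetaNumerators.

Section BetaIntegral.
Context {R : realType}.
Notation mu := (@lebesgue_measure R).
Implicit Types (a b t s x : R) (f g q : R -> R).

(** A negative number to a real power is 1 by convention, so the power is not
    continuous at 0; truncating the base makes it continuous on the line without
    changing it on the unit interval. *)
Definition pos_powR a t : R := Num.max t 0 `^ a.

Lemma pos_powRE a t : 0 <= t -> pos_powR a t = t `^ a.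
Proof. by move=> t0; rewrite /pos_powR max_l. Qed.

Lemma continuous_pos_powR a : 0 < a -> continuous (pos_powR a).
Proof.
move=> a0 t; have [t0|t0|<-] := ltgtP 0 t.
- have : {for t, continuous (fun y : R => y `^ a)}.
    apply: differentiable_continuous; apply/derivable1_diffP.
    by apply: derivable_powR; rewrite in_itv /= t0.
  rewrite /continuous_at pos_powRE ?ltW // => H.
  apply: cvg_trans H; apply: near_eq_cvg; near=> y.
  by rewrite pos_powRE // ltW //; near: y; exact: lt_nbhsr.
- rewrite /continuous_at /pos_powR (max_r (ltW t0)) powR0 ?gt_eqF //.
  apply: (cvg_trans _ (@cvg_cst _ 0 _ (nbhs t) _)).
  apply: near_eq_cvg; near=> y.
  rewrite max_r ?powR0 ?gt_eqF // ltW //; near: y; exact: lt_nbhsl.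
- apply/cvgrPdist_lt => e e0.
  apply/nbhs_ballP; exists (e `^ a^-1) => /=; first exact: powR_gt0.
  move=> y; rewrite /ball /= sub0r normrN => ye.
  rewrite {1}/pos_powR maxxx powR0 ?gt_eqF // sub0r normrN ger0_norm ?powR_ge0 //.
  have -> : e = (e `^ a^-1) `^ a by rewrite -powRrM mulVf ?gt_eqF // powRr1 // ltW.
  apply: gt0_ltr_powR; rewrite ?nnegrE ?powR_ge0 ?le_max ?lexx ?orbT //.
  by rewrite gt_max powR_gt0 // andbT (le_lt_trans (ler_norm y)).
Unshelve. all: by end_near. Qed.

Lemma within_continuous_eq f g : (forall t, 0 <= t <= 1 -> f t = g t) ->
  continuous f -> {within `[0, 1], continuous g}.
Proof.
move=> fg fc; apply/subspace_continuousP => t t01.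
have fgA y : `[0, 1]%classic y -> f y = g y by rewrite /= in_itv; exact: fg.
suff H : g @ within `[0, 1] (nbhs (t : R)) --> g t by exact: H.
rewrite -(fgA _ t01); apply: (@cvg_trans _ (f @ within `[0, 1] (nbhs (t : R)))).
  by apply: fmap_within_eq => y /set_mem y01; rewrite fgA.
by apply: cvg_within_filter; exact: fc.
Qed.

Lemma within_continuous_powR a : 0 <= a ->
  {within `[0, 1], continuous (fun t => t `^ a : R)} /\
  {within `[0, 1], continuous (fun t => (1 - t) `^ a : R)}.
Proof.
rewrite le_eqVlt => /predU1P[<-|a0].
  split; [apply: (@within_continuous_eq (cst 1))|apply: (@within_continuous_eq (cst 1))];
    by [move=> t _; rewrite powRr0|exact: cst_continuous].
split.
  apply: (@within_continuous_eq (pos_powR a)); last exact: continuous_pos_powR.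
  by move=> t /andP[t0 _]; rewrite pos_powRE.
apply: (@within_continuous_eq (fun t => pos_powR a (1 - t))).
  by move=> t /andP[_ t1]; rewrite pos_powRE // subr_ge0.
move=> t; apply: (@continuous_comp _ _ _ (fun t => 1 - t) (pos_powR a)).
  by apply: cvgB; [exact: cvg_cst|exact: cvg_id].
exact: continuous_pos_powR.
Qed.

Definition beta_weight a b t : R := t `^ a * (1 - t) `^ b.

Lemma within_continuousM f g : {within `[0, 1], continuous f} ->
  {within `[0, 1], continuous g} -> {within `[0, 1], continuous (fun t : R => f t * g t)}.
Proof. by move=> fc gc t; apply: continuousM; [exact: fc|exact: gc]. Qed.

Lemma within_continuous_beta_weight a b : 0 <= a -> 0 <= b ->
  {within `[0, 1], continuous (beta_weight a b)}.
Proof.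
move=> a0 b0; apply: within_continuousM.
  by have [] := within_continuous_powR a0.
by have [] := within_continuous_powR b0.
Qed.

Lemma integrable_continuous f : {within `[0, 1], continuous f} ->
  mu.-integrable `[0, 1] (EFin \o f).
Proof. by move=> fc; apply: continuous_compact_integrable => //; exact: segment_compact. Qed.

(** The integrand is the derivative of t^(a+1) (1-t)^(b+1) q(t), which vanishes at
    both ends. *)
Lemma beta_integration_by_parts a b q dq : 0 <= a -> 0 <= b ->
  continuous dq -> (forall t, is_derive t (1:R) q (dq t)) ->
  \int[mu]_(t in `[0, 1])
    (beta_weight a b t * (((a + 1) * (1 - t) - (b + 1) * t) * q t + t * (1 - t) * dq t)) = 0.
Proof.
move=> a0 b0 dqc dqE.
have qc : continuous q.
  by move=> t; apply: differentiable_continuous; apply/derivable1_diffP.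
have a1 : 0 < a + 1 by rewrite ltr_wpDl.
have b1 : 0 < b + 1 by rewrite ltr_wpDl.
pose F t := pos_powR (a + 1) t * pos_powR (b + 1) (1 - t) * q t.
have Fc : continuous F.
  move=> t; apply: cvgM; last exact: qc.
  apply: cvgM; first exact: continuous_pos_powR.
  apply: (@continuous_comp _ _ _ (fun t => 1 - t) (pos_powR (b + 1))).
    by apply: cvgB; [exact: cvg_cst|exact: cvg_id].
  exact: continuous_pos_powR.
pose f t := beta_weight a b t * (((a + 1) * (1 - t) - (b + 1) * t) * q t + t * (1 - t) * dq t).
have fc : {within `[0, 1], continuous f}.
  apply: within_continuousM; first exact: within_continuous_beta_weight.
  apply: continuous_subspaceT => t.
  apply: cvgD; apply: cvgM; last exact: dqc.
  - apply: cvgB; apply: cvgM; [exact: cvg_cst| |exact: cvg_cst|exact: cvg_id].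
    by apply: cvgB; [exact: cvg_cst|exact: cvg_id].
  - exact: qc.
  - by apply: cvgM; [exact: cvg_id|apply: cvgB; [exact: cvg_cst|exact: cvg_id]].
have dF t : t \in `]0, 1[ -> is_derive t (1:R) F (f t).
  rewrite in_itv /= => /andP[t0 t1].
  have t1' : 0 < 1 - t by rewrite subr_gt0.
  pose G (y : R) : R := y `^ (a + 1) * (1 - y) `^ (b + 1) * q y.
  apply: (@near_eq_is_derive _ _ _ G).
    near=> y; rewrite /F /G !pos_powRE //.
      by rewrite subr_ge0 ltW //; near: y; exact: lt_nbhsl.
    by rewrite ltW //; near: y; exact: lt_nbhsr.
  have dI : is_derive t 1 (fun y : R => 1 - y) (- 1).
    by apply: is_derive_eq; rewrite add0r mul1r.
  have dA := is_derive1_powR (a + 1) t0.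
  have dB : is_derive t 1 (fun y : R => (1 - y) `^ (b + 1)) (- ((b + 1) * (1 - t) `^ (b + 1 - 1))).
    have := @is_derive1_comp R (fun y => y `^ (b + 1)) (fun y => 1 - y) t _ _
      (is_derive1_powR (b + 1) t1') dI.
    by rewrite mulrN1.
  have := is_deriveM (is_deriveM dA dB) (dqE t).
  rewrite (_ : ((fun y => y `^ (a + 1)) * (fun y => (1 - y) `^ (b + 1))) * q = G) // => dG.
  apply: (@is_derive_eq _ _ _ _ _ _ _ _ dG).
  rewrite /GRing.scale /= !addrK /f /beta_weight.
  have E1 (y c : R) : 0 < y -> y `^ (c + 1) = y * y `^ c.
    move=> y0; have yn0 : y != 0 by rewrite gt_eqF.
    by rewrite powRD ?yn0 ?implybT // powRr1 ?ltW // mulrC.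
  rewrite !fctE !E1 //; ring.
rewrite /Rintegral (@continuous_FTC2 _ f F) //.
- have pos0 c : 0 < c -> pos_powR c 0 = 0.
    by move=> c0; rewrite /pos_powR maxxx powR0 // gt_eqF.
  by rewrite /= /F subrr !pos0 // mulr0 !mul0r subrr.
- split=> [t /dF //||]; [apply: cvg_at_right_filter|apply: cvg_at_left_filter]; exact: Fc.
- by move=> t /dF H; rewrite derive1E derive_val.
Unshelve. all: by end_near. Qed.

End BetaIntegral.

Section BetaMoments.
Context {R : realType}.
Notation mu := (@lebesgue_measure R).
Implicit Types (a b t s x : R) (f g q : R -> R).

Definition beta_moment a b x j :=
  \int[mu]_(t in `[0, 1]) (beta_weight a b t * (t - x) ^+ j).

Lemma continuous_center_expr x j : continuous (fun t : R => (t - x) ^+ j).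
Proof.
move=> t; apply: (@continuous_comp _ _ _ (fun t => t - x) (fun y : R => y ^+ j)).
  by apply: cvgB; [exact: cvg_id|exact: cvg_cst].
exact: exprn_continuous.
Qed.

Lemma is_derive_center_expr x j t :
  is_derive t (1 : R) (fun y : R => (y - x) ^+ j) (j%:R * (t - x) ^+ j.-1).
Proof.
have dI : is_derive t 1 (fun y : R => y - x) 1.
  by apply: is_derive_eq; rewrite oppr0 addr0.
have := is_deriveX j dI; rewrite /GRing.scale /= mulr1.
by rewrite (_ : (fun y => y - x) ^+ j = fun y => (y - x) ^+ j) // exprfctE.
Qed.

(** Integration by parts with q = (t - x)^j, after expanding t and t (1 - t) in
    powers of t - x.  At j = 0 the truncated index j.-1 has coefficient 0. *)
Lemma beta_moment_rec a b x j : 0 <= a -> 0 <= b ->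
  (a + b + 2 + j%:R) * beta_moment a b x j.+1
  = (a + 1 - (a + b + 2) * x + j%:R * (1 - 2 * x)) * beta_moment a b x j
    + j%:R * (x * (1 - x)) * beta_moment a b x j.-1.
Proof.
move=> a0 b0.
pose w j t := beta_weight a b t * (t - x) ^+ j.
have cw i : {within `[0, 1], continuous (w i)}.
  apply: within_continuousM; first exact: within_continuous_beta_weight.
  exact/continuous_subspaceT/continuous_center_expr.
have cwZ c i : {within `[0, 1], continuous (fun t => c * w i t)}.
  by apply: within_continuousM => //; apply: continuous_subspaceT => t; exact: cvg_cst.
have iw i : mu.-integrable `[0, 1] (EFin \o w i) by exact: integrable_continuous.
have iwZ c i : mu.-integrable `[0, 1] (EFin \o (fun t => c * w i t)).
  exact: integrable_continuous.
have dqc : continuous (fun t : R => j%:R * (t - x) ^+ j.-1).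
  by move=> t; apply: cvgM; [exact: cvg_cst|exact: continuous_center_expr].
have := beta_integration_by_parts a0 b0 dqc (is_derive_center_expr x j).
pose c1 := a + 1 - (a + b + 2) * x + j%:R * (1 - 2 * x).
pose c2 := j%:R * (x * (1 - x)).
pose c3 := - (a + b + 2 + j%:R).
under eq_Rintegral => t _.
  rewrite (_ : _ * _ = c1 * w j t + (c2 * w j.-1 t + c3 * w j.+1 t)); last first.
    rewrite /w /c1 /c2 /c3; case: j {dqc c1 c2 c3} => [|j] /=.
      by rewrite expr0 expr1; ring.
    by rewrite !exprS -[j.+1]addn1 natrD; ring.
  over.
rewrite /= RintegralD //; last first.
  by apply: integrable_continuous; apply: within_continuousD.
rewrite RintegralD // !RintegralZl // => H.
have {}H : c1 * beta_moment a b x j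
    + (c2 * beta_moment a b x j.-1 + c3 * beta_moment a b x j.+1) = 0 by exact: H.
rewrite -/c1 -/c2 (_ : a + b + 2 + j%:R = - c3); last by rewrite /c3 opprK.
by apply/eqP; rewrite -subr_eq0 -[X in _ == X]oppr0 -[X in _ == - X]H; apply/eqP; ring.
Qed.

Definition rising s j : R := \prod_(0 <= i < j) (s + i%:R).

Lemma rising_gt0 s j : 0 < s -> 0 < rising s j.
Proof.
by move=> s0; rewrite /rising; apply: prodr_gt0 => i _; rewrite ltr_pwDl.
Qed.

Lemma beta_momentE a b x j : 0 <= a -> 0 <= b ->
  beta_moment a b x j * rising (a + b + 2) j
  = beta_num (a + 1) (a + b + 2) x j * beta_moment a b x 0.
Proof.
move=> a0 b0.
have rS i : rising (a + b + 2) i.+1 = rising (a + b + 2) i * (a + b + 2 + i%:R).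
  by rewrite /rising big_nat_recr.
have r0 : rising (a + b + 2) 0 = 1 by rewrite /rising big_nil.
suff: beta_moment a b x j * rising (a + b + 2) j
  = beta_num (a + 1) (a + b + 2) x j * beta_moment a b x 0 /\
  beta_moment a b x j.+1 * rising (a + b + 2) j.+1
  = beta_num (a + 1) (a + b + 2) x j.+1 * beta_moment a b x 0 by case.
elim: j => [|j [IH0 IH1]]; split=> //.
- by rewrite r0 mulr1 mul1r.
- by rewrite rS r0 mul1r [LHS]mulrC beta_moment_rec //=; ring.
- set s := a + b + 2 in rS IH0 IH1 *.
  have rec : (s + j.+1%:R) * beta_moment a b x j.+2 =
      (a + 1 - s * x + j.+1%:R * (1 - 2 * x)) * beta_moment a b x j.+1
      + j.+1%:R * (x * (1 - x)) * beta_moment a b x j.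
    exact: beta_moment_rec.
  transitivity (((s + j.+1%:R) * beta_moment a b x j.+2) * rising s j.+1).
    by rewrite [rising s j.+2]rS; ring.
  rewrite rec mulrDl -mulrA IH1 rS.
  transitivity ((a + 1 - s * x + j.+1%:R * (1 - 2 * x))
      * (beta_num (a + 1) s x j.+1 * beta_moment a b x 0)
    + j.+1%:R * (x * (1 - x)) * (s + j%:R) * (beta_moment a b x j * rising s j)).
    by ring.
  by rewrite IH0 beta_numSS; ring.
Qed.

(** Integer exponents above a and b give a smaller integrand, and for these the
    integral is a quotient of factorials. *)
Lemma beta_moment0_gt0 a b x : 0 <= a -> 0 <= b -> 0 < beta_moment a b x 0.
Proof.
move=> a0 b0.
have [p ap] : exists p : nat, a <= p%:R.
  by exists (Num.truncn a).+1; rewrite ltW // truncnS_gt.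
have [r br] : exists r : nat, b <= r%:R.
  by exists (Num.truncn b).+1; rewrite ltW // truncnS_gt.
apply: (lt_le_trans (@beta_fun_gt0 R p.+2 r.+2)).
rewrite /beta_fun -Rintegral_mkcond /beta_moment.
have mono (c y : R) (m : nat) : 0 <= c -> c <= m%:R -> 0 <= y <= 1 -> y ^+ m.+1 <= y `^ c.
  move=> c0 cm /andP[]; rewrite le_eqVlt => /predU1P[<-|y0] y1.
    by rewrite expr0n powR_ge0.
  have y01 : 0 < y <= 1 by rewrite y0.
  rewrite -powR_mulrn ?(ltW y0) //; apply: (ger_powR y01).
  by rewrite (le_trans cm) // ler_nat.
apply: le_Rintegral => //.
- exact: integrable_XMonemX.
- apply: integrable_continuous; apply: within_continuousM.
    exact: within_continuous_beta_weight.
  exact/continuous_subspaceT/continuous_center_expr.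
- move=> t /=; rewrite in_itv /= => t01; have /andP[t0 t1] := t01.
  rewrite expr0 mulr1 /beta_weight.
  have /andP[u0 u1] : 0 <= 1 - t <= 1 by apply/andP; split; lra.
  by apply: ler_pM; [exact: exprn_ge0|exact: exprn_ge0 u0|exact: mono|
    apply: mono; rewrite ?u0].
Qed.

Lemma paltanea_densityE (rho : R) n k t :
  paltanea_density rho n k t
  = (beta_moment (k%:R * rho) ((n - k)%:R * rho) 0 0)^-1
    * beta_weight (k%:R * rho) ((n - k)%:R * rho) t.
Proof.
rewrite /paltanea_density mulrC /beta_weight; congr (_^-1 * _).
apply: eq_Rintegral => y _.
by rewrite !addrK expr0 mulr1.
Qed.

Section Mean.
Context (rho : R) (n k : nat).
Context (rho_gt0 : 0 < rho).

Let a0 : 0 <= k%:R * rho. Proof. by rewrite mulr_ge0 // ltW. Qed.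
Let b0 : 0 <= (n - k)%:R * rho. Proof. by rewrite mulr_ge0 // ltW. Qed.

Definition paltanea_mean f := \int[mu]_(t in `[0, 1]) (paltanea_density rho n k t * f t).

Lemma paltanea_density_ge0 t : 0 <= paltanea_density rho n k t.
Proof.
rewrite paltanea_densityE; apply: mulr_ge0.
  by rewrite invr_ge0; apply/ltW/beta_moment0_gt0.
by apply: mulr_ge0; exact: powR_ge0.
Qed.

Lemma integrable_paltanea_density f : {within `[0, 1], continuous f} ->
  mu.-integrable `[0, 1] (EFin \o (fun t => paltanea_density rho n k t * f t)).
Proof.
move=> fc; apply: integrable_continuous; apply: within_continuousM => //.
rewrite (_ : paltanea_density _ _ _ = fun t =>
  (beta_moment (k%:R * rho) ((n - k)%:R * rho) 0 0)^-1
    * beta_weight (k%:R * rho) ((n - k)%:R * rho) t); last first.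
  by apply/funext => t; rewrite paltanea_densityE.
apply: within_continuousM; last exact: within_continuous_beta_weight.
by apply: continuous_subspaceT => t; exact: cvg_cst.
Qed.

Lemma paltanea_meanD f g : {within `[0, 1], continuous f} ->
  {within `[0, 1], continuous g} ->
  paltanea_mean (fun t => f t + g t) = paltanea_mean f + paltanea_mean g.
Proof.
move=> fc gc; rewrite /paltanea_mean -RintegralD //; last 2 first.
- exact: integrable_paltanea_density.
- exact: integrable_paltanea_density.
by apply: eq_Rintegral => t _; rewrite mulrDr.
Qed.

Lemma paltanea_meanZ c f : {within `[0, 1], continuous f} ->
  paltanea_mean (fun t => c * f t) = c * paltanea_mean f.
Proof.
move=> fc; rewrite /paltanea_mean -RintegralZl //; last first.
  exact: integrable_paltanea_density.
by apply: eq_Rintegral => t _; rewrite mulrCA.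
Qed.

Lemma paltanea_mean_norm_le f g : {within `[0, 1], continuous f} ->
  {within `[0, 1], continuous g} -> (forall t, 0 <= t <= 1 -> `|f t| <= g t) ->
  `|paltanea_mean f| <= paltanea_mean g.
Proof.
move=> fc gc fg; apply: (le_trans (le_normr_Rintegral _ _)) => //.
  exact: integrable_paltanea_density.
apply: le_Rintegral => //.
- have := integrable_paltanea_density fc.
  by move=> /integrable_norm; apply: eq_integrable.
- exact: integrable_paltanea_density.
- move=> t /=; rewrite in_itv /= => t01.
  by rewrite normrM ger0_norm ?paltanea_density_ge0 // ler_wpM2l ?paltanea_density_ge0 // fg.
Qed.

Lemma paltanea_mean_center x j : (k <= n)%N ->
  paltanea_mean (fun t => (t - x) ^+ j)
  = beta_num (k%:R * rho + 1) (n%:R * rho + 2) x j / rising (n%:R * rho + 2) j.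
Proof.
move=> kn.
have -> : n%:R * rho + 2 = k%:R * rho + (n - k)%:R * rho + 2.
  by rewrite natrB //; ring.
set B := beta_moment (k%:R * rho) ((n - k)%:R * rho) 0 0.
have B0 : B != 0 by rewrite gt_eqF // beta_moment0_gt0.
have Bx : beta_moment (k%:R * rho) ((n - k)%:R * rho) x 0 = B.
  by rewrite /B /beta_moment; apply: eq_Rintegral => t _; rewrite !expr0.
have -> : paltanea_mean (fun t => (t - x) ^+ j)
    = B^-1 * beta_moment (k%:R * rho) ((n - k)%:R * rho) x j.
  rewrite /paltanea_mean /beta_moment -RintegralZl //; last first.
    apply: integrable_continuous; apply: within_continuousM.
      exact: within_continuous_beta_weight.
    exact/continuous_subspaceT/continuous_center_expr.
  by apply: eq_Rintegral => t _; rewrite paltanea_densityE mulrA.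
have := beta_momentE x j a0 b0; rewrite Bx.
have : rising (k%:R * rho + (n - k)%:R * rho + 2) j != 0.
  by rewrite gt_eqF // rising_gt0 // ltr_wpDl // addr_ge0.
set r := rising _ _ => r0 H.
by apply: (mulIf r0); rewrite -mulrA H mulfVK // mulrA mulrAC mulVf // mul1r.
Qed.

End Mean.
End BetaMoments.

(** * The five-point stencil and its moments *)

Section Coefficients.
Context {R : realType} (alpha rho x : R).
Context (rho_gt0 : 0 < rho).

(** The weights of the operator, moved from the basis functions to the values they
    multiply: the shift of the basis by i becomes a shift of g by i. *)
Definition stencil n (g : nat -> R) k :=
  coef_a alpha rho n x * g k + coef_b alpha rho n x * g k.+1
  + coef_d rho n x * g k.+2 + coef_b alpha rho n (1 - x) * g k.+3
  + coef_a alpha rho n (1 - x) * g k.+4.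

(** The Newton coefficients of orders one, two and three are determined by the
    vanishing of the first three moments: these formulas solve that triangular
    system.  As the variance and the third moment are affine in n, so are they. *)
Definition newton1 : R := - (bias x rho / rho).

Definition newton2 (n : R) : R :=
  - (rho ^+ 2 * alpha_var x alpha n + x * (1 - x) * (n * rho + 2)
     - bias x rho ^+ 2 - bias x rho * rho) / (2 * rho ^+ 2).

Definition newton3 (n : R) : R :=
  - (rho ^+ 3 * alpha_third x alpha n
     - 3 * (rho ^+ 2 * alpha_var x alpha n + x * (1 - x) * (n * rho + 2))
         * (bias x rho + rho)
     - (1 - 2 * x) * (x * (1 - x)) * (n * rho + 2)
     + bias x rho * (bias x rho + rho) * (bias x rho + 2 * rho)) / (6 * rho ^+ 3).

(** In the coefficients of orders 0 to 3 the quadratic parts in n of the stencil,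
    which are proportional to 1, -4, 6, -4, 1, cancel. *)
Lemma stencil_newton n g :
  stencil n g = newton newton1 (newton2 n%:R) (newton3 n%:R)
                       (coef_a alpha rho n (1 - x)) g.
Proof.
have rho0 : rho != 0 by rewrite gt_eqF.
pose S := coef_a alpha rho n x + coef_b alpha rho n x + coef_d rho n x
    + coef_b alpha rho n (1 - x) + coef_a alpha rho n (1 - x).
have e0 : S = 1.
  rewrite /S /coef_a /coef_b /coef_d /coef_a0 /coef_a1 /coef_a2 /coef_a3 /coef_a4.
  rewrite /coef_b0 /coef_b1 /coef_b2 /coef_b3 /coef_b4 /coef_d0.
  by field.
have e1 : coef_b alpha rho n x + 2 * coef_d rho n x
    + 3 * coef_b alpha rho n (1 - x) + 4 * coef_a alpha rho n (1 - x) = newton1.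
  rewrite /coef_a /coef_b /coef_d /coef_a0 /coef_a1 /coef_a2 /coef_a3 /coef_a4.
  rewrite /coef_b0 /coef_b1 /coef_b2 /coef_b3 /coef_b4 /coef_d0 /newton1 /bias.
  by field.
have e2 : coef_d rho n x
    + 3 * coef_b alpha rho n (1 - x) + 6 * coef_a alpha rho n (1 - x) = newton2 n%:R.
  rewrite /coef_a /coef_b /coef_d /coef_a0 /coef_a1 /coef_a2 /coef_a3 /coef_a4.
  rewrite /coef_b0 /coef_b1 /coef_b2 /coef_b3 /coef_b4 /coef_d0 /newton2 /bias /alpha_var.
  by field.
have e3 : coef_b alpha rho n (1 - x) + 4 * coef_a alpha rho n (1 - x) = newton3 n%:R.
  rewrite /coef_a /coef_b /coef_a0 /coef_a1 /coef_a2 /coef_a3 /coef_a4.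
  rewrite /coef_b0 /coef_b1 /coef_b2 /coef_b3 /coef_b4 /newton3 /bias /alpha_var /alpha_third.
  by field.
apply/funext => k; rewrite /newton -e1 -e2 -e3.
apply/eqP; rewrite -subr_eq0; apply/eqP.
transitivity ((S - 1) * g k); last by rewrite e0 subrr mul0r.
by rewrite /S /stencil /fdiff; ring.
Qed.

(** The leading coefficient is explicit because it decides the fourth moment of the
    operator. *)
Lemma coef_a_quadratic y : exists q0 q1 : R, forall n,
  coef_a alpha rho n y
  = q0 + q1 * n%:R + (y * (1 - y)) ^+ 2 * (1 + rho) ^+ 2 / (8 * rho ^+ 2) * n%:R ^+ 2.
Proof.
have rho0 : rho != 0 by rewrite gt_eqF.
exists (coef_a alpha rho 0 y).
exists (coef_a alpha rho 1 y - coef_a alpha rho 0 y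
   - (y * (1 - y)) ^+ 2 * (1 + rho) ^+ 2 / (8 * rho ^+ 2)) => n.
rewrite /coef_a /coef_a0 /coef_a1 /coef_a2 /coef_a3 /coef_a4.
by field.
Qed.

Lemma stencil_moment1 N :
  alpha_mean x alpha N (stencil (N + 6) (paltanea_num rho x 1 N)) = 0.
Proof.
have rho0 : rho != 0 by rewrite gt_eqF.
rewrite stencil_newton.
rewrite (_ : paltanea_num rho x 1 N = fun k => bias x rho + rho * center x N k
  + 0 * center x N k ^+ 2 + 0 * center x N k ^+ 3 + 0 * center x N k ^+ 4); last first.
  by apply/funext => k; rewrite /paltanea_num [LHS]paltanea_center; ring.
by rewrite alpha_mean_newton_quartic /newton1; field.
Qed.

Lemma stencil_moment2 N :
  alpha_mean x alpha N (stencil (N + 6) (paltanea_num rho x 2 N)) = 0.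
Proof.
have rho0 : rho != 0 by rewrite gt_eqF.
rewrite stencil_newton.
pose d := bias x rho; pose t := 1 - 2 * x.
pose s := (N + 6)%:R * rho + 2.
rewrite (_ : paltanea_num rho x 2 N = fun k =>
  (d ^+ 2 + t * d + x * (1 - x) * s) + (2 * rho * d + t * rho) * center x N k
  + rho ^+ 2 * center x N k ^+ 2 + 0 * center x N k ^+ 3 + 0 * center x N k ^+ 4); last first.
  apply/funext => k.
  rewrite /paltanea_num beta_numSS [beta_num _ _ _ 1]/= paltanea_center.
  by rewrite [beta_num _ _ _ 0]/= -/d -/s -/t; ring.
by rewrite alpha_mean_newton_quartic /newton1 /newton2 -/d -/s; field.
Qed.

Lemma paltanea_num3 N :
  let d := bias x rho in let t := 1 - 2 * x in let X := x * (1 - x) in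
  let s := (N + 6)%:R * rho + 2 in
  let B := 2 * t ^+ 2 + 3 * X * s + 2 * X in
  paltanea_num rho x 3 N = fun k =>
  (d ^+ 3 + 3 * t * d ^+ 2 + B * d + 2 * t * X * s)
  + (rho * (3 * d ^+ 2 + 6 * t * d + B)) * center x N k
  + (rho ^+ 2 * (3 * d + 3 * t)) * center x N k ^+ 2
  + rho ^+ 3 * center x N k ^+ 3 + 0 * center x N k ^+ 4.
Proof.
move=> d t X s B; apply/funext => k.
rewrite /paltanea_num !beta_numSS [beta_num _ _ _ 1]/= paltanea_center.
rewrite [beta_num _ _ _ 0]/= -/d -/s -/t -/X /B; ring.
Qed.

Lemma stencil_moment3 N :
  alpha_mean x alpha N (stencil (N + 6) (paltanea_num rho x 3 N)) = 0.
Proof.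
have rho0 : rho != 0 by rewrite gt_eqF.
rewrite stencil_newton paltanea_num3.
set d := bias x rho; set s := (N + 6)%:R * rho + 2.
by rewrite alpha_mean_newton_quartic /newton1 /newton2 /newton3 -/d -/s; field.
Qed.

Lemma paltanea_num4 N :
  let d := bias x rho in let t := 1 - 2 * x in let X := x * (1 - x) in
  let s := (N + 6)%:R * rho + 2 in
  let B := 2 * t ^+ 2 + 3 * X * s + 2 * X in
  let q2 := B + 9 * t ^+ 2 + 3 * X * (s + 2) in
  let q1 := 2 * t * X * s + 3 * t * B + 3 * X * (s + 2) * t in
  let q0 := 6 * t ^+ 2 * X * s + 3 * X ^+ 2 * s * (s + 2) in
  paltanea_num rho x 4 N = fun k =>
  (d ^+ 4 + 6 * t * d ^+ 3 + q2 * d ^+ 2 + q1 * d + q0)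
  + (rho * (4 * d ^+ 3 + 18 * t * d ^+ 2 + 2 * q2 * d + q1)) * center x N k
  + (rho ^+ 2 * (6 * d ^+ 2 + 18 * t * d + q2)) * center x N k ^+ 2
  + (rho ^+ 3 * (4 * d + 6 * t)) * center x N k ^+ 3
  + rho ^+ 4 * center x N k ^+ 4.
Proof.
move=> d t X s B q2 q1 q0; apply/funext => k.
rewrite /paltanea_num !beta_numSS [beta_num _ _ _ 1]/= paltanea_center.
rewrite [beta_num _ _ _ 0]/= -/d -/s -/t -/X /q2 /q1 /q0 /B; ring.
Qed.

(** Weight alone gives a quadratic bound in n.  The quadratic term vanishes because
    the leading coefficients of the Newton coefficients of orders two and four
    balance those of the variance and of the fourth moments. *)
Lemma stencil_moment4 :
  poly_growth 1 (fun N => alpha_mean x alpha N (stencil (N + 6) (paltanea_num rho x 4 N))).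
Proof.
have rho0 : rho != 0 by rewrite gt_eqF.
have [r0 [r1 aE]] := coef_a_quadratic (1 - x).
suff [A [B AB]] : exists A B : R, forall N, alpha_mean x alpha N
    (stencil (N + 6) (paltanea_num rho x 4 N)) = A + B * (N + 6)%:R.
  rewrite (_ : (fun N => _) = fun N => A + B * (N + 6)%:R); last exact/funext.
  apply: poly_growthD; first exact: poly_growth_mono (leq0n 1) (poly_growth_cst A).
  exact: poly_growthZ poly_growth_degree.
pose X := x * (1 - x).
have [V0 vE] : exists V0, forall n, alpha_var x alpha n = V0 + X * n.
  by exists (alpha_var x alpha 0) => n; rewrite /alpha_var /X; ring.
have [T0 [T1 tE]] : exists T0 T1, forall n, alpha_third x alpha n = T0 + T1 * n.
  exists (alpha_third x alpha 0), (alpha_third x alpha 1 - alpha_third x alpha 0) => n.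
  by rewrite /alpha_third; ring.
have [F0 [F1 fE]] : exists F0 F1, forall n,
    alpha_fourth x alpha n = F0 + F1 * n + 3 * X ^+ 2 * n ^+ 2.
  exists (alpha_fourth x alpha 0).
  exists (alpha_fourth x alpha 1 - alpha_fourth x alpha 0 - 3 * X ^+ 2) => n.
  by rewrite /alpha_fourth /X; ring.
have [A2 n2E] : exists A2, forall n,
    newton2 n = A2 - X * (1 + rho) / (2 * rho) * n.
  by exists (newton2 0) => n; rewrite /newton2 /alpha_var /X; field.
have [A3 [B3 n3E]] : exists A3 B3, forall n, newton3 n = A3 + B3 * n.
  exists (newton3 0), (newton3 1 - newton3 0) => n.
  by rewrite /newton3 /alpha_var /alpha_third; field.
pose d := bias x rho; pose t := 1 - 2 * x.
have X1 : (1 - x) * (1 - (1 - x)) = X by rewrite /X; ring.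
pose c2 := X * (1 + rho) / (2 * rho).
pose c4 := X ^+ 2 * (1 + rho) ^+ 2 / (8 * rho ^+ 2).
(* The fourth moment as a polynomial in n.  It has degree two, so once its leading
   coefficient vanishes it is affine, hence given by its values at 0 and 1. *)
pose phi (n : R) : R :=
  let s : R := n * rho + 2 in
  let B : R := 2 * t ^+ 2 + 3 * X * s + 2 * X in
  let q2 : R := B + 9 * t ^+ 2 + 3 * X * (s + 2) in
  let q1 : R := 2 * t * X * s + 3 * t * B + 3 * X * (s + 2) * t in
  let q0 : R := 6 * t ^+ 2 * X * s + 3 * X ^+ 2 * s * (s + 2) in
  let p0 : R := d ^+ 4 + 6 * t * d ^+ 3 + q2 * d ^+ 2 + q1 * d + q0 in
  let p1 : R := rho * (4 * d ^+ 3 + 18 * t * d ^+ 2 + 2 * q2 * d + q1) in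
  let p2 : R := rho ^+ 2 * (6 * d ^+ 2 + 18 * t * d + q2) in
  let p3 : R := rho ^+ 3 * (4 * d + 6 * t) in
  let p4 : R := rho ^+ 4 in
  let v : R := V0 + X * n in let th : R := T0 + T1 * n in
  let fo : R := F0 + F1 * n + 3 * X ^+ 2 * n ^+ 2 in
  p0 + p2 * v + p3 * th + p4 * fo
    + newton1 * (p1 + p2 + p3 * (3 * v + 1) + p4 * (4 * th + 6 * v + 1))
    + (A2 - c2 * n) * (2 * p2 + 6 * p3 + p4 * (12 * v + 14))
    + (A3 + B3 * n) * (6 * p3 + 36 * p4)
    + 24 * (r0 + r1 * n + c4 * n ^+ 2) * p4.
have phi_quadratic n : phi n = phi 0 + (phi 1 - phi 0) * n
    + (3 * X ^+ 2 * rho ^+ 2 * (1 + rho) ^+ 2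
       - 12 * c2 * X * rho ^+ 3 * (1 + rho) + 24 * c4 * rho ^+ 4) * (n ^+ 2 - n).
  by rewrite /phi; ring.
exists (phi 0), (phi 1 - phi 0) => N.
have K0 : 3 * X ^+ 2 * rho ^+ 2 * (1 + rho) ^+ 2
    - 12 * c2 * X * rho ^+ 3 * (1 + rho) + 24 * c4 * rho ^+ 4 = 0.
  by rewrite /c2 /c4; field.
transitivity (phi (N + 6)%:R); last by rewrite phi_quadratic K0 mul0r addr0.
rewrite stencil_newton aE paltanea_num4 alpha_mean_newton_quartic.
by rewrite vE tE fE n2E n3E X1.
Qed.

End Coefficients.

(** * Rate of convergence *)

Section Final.
Context {R : realType} (alpha rho x : R).
Context (rho_gt0 : 0 < rho).

Lemma poly_growth_quadratic (q0 q1 q2 : R) :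
  poly_growth 2 (fun N => q0 + q1 * (N + 6)%:R + q2 * (N + 6)%:R ^+ 2).
Proof.
apply: poly_growthD; last first.
  rewrite (_ : (fun N => _) = (fun N => q2 * ((N + 6)%:R * (N + 6)%:R))).
    by apply: poly_growthZ; apply: poly_growthM poly_growth_degree poly_growth_degree.
  by apply/funext => N; rewrite expr2.
apply: poly_growthD.
  exact: poly_growth_mono (leq0n 2) (poly_growth_cst q0).
by apply: poly_growth_mono (leqnSn 1) _; apply: poly_growthZ poly_growth_degree.
Qed.

Lemma coef_growth y :
  [/\ poly_growth 2 (fun N => coef_a alpha rho (N + 6) y),
      poly_growth 2 (fun N => coef_b alpha rho (N + 6) y)
    & poly_growth 2 (fun N => coef_d rho (N + 6) y)].
Proof.
have rho0 : rho != 0 by rewrite gt_eqF.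
split.
- have [q0 [q1 aE]] := coef_a_quadratic alpha rho_gt0 y.
  set q2 := _ / _ in aE.
  rewrite (_ : (fun N => _) = fun N => q0 + q1 * (N + 6)%:R + q2 * (N + 6)%:R ^+ 2).
    exact: poly_growth_quadratic.
  by apply/funext => N; rewrite aE.
- pose q0 := coef_b alpha rho 0 y.
  pose q2 := (coef_b alpha rho 2 y - 2 * coef_b alpha rho 1 y + q0) / 2.
  pose q1 := coef_b alpha rho 1 y - q0 - q2.
  rewrite (_ : (fun N => _) = fun N => q0 + q1 * (N + 6)%:R + q2 * (N + 6)%:R ^+ 2).
    exact: poly_growth_quadratic.
  apply/funext => N; rewrite /q1 /q2 /q0.
  rewrite /coef_b /coef_b0 /coef_b1 /coef_b2 /coef_b3 /coef_b4.
  by field.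
- rewrite (_ : (fun N => _) = fun N => 0 + 0 * (N + 6)%:R +
      (3 * (1 + rho) ^+ 2 / (4 * rho ^+ 2) * y ^+ 2 * (1 - y) ^+ 2) * (N + 6)%:R ^+ 2).
    exact: poly_growth_quadratic.
  by apply/funext => N; rewrite /coef_d /coef_d0; field.
Qed.

Lemma graded_stencil w g : graded x w g ->
  graded x w (fun N => stencil alpha rho x (N + 6) (g N)).
Proof.
have rho0 : rho != 0 by rewrite gt_eqF.
move=> g0; have g1 := graded_fdiff g0; have g2 := graded_fdiff g1.
have g3 := graded_fdiff g2; have g4 := graded_fdiff g3.
have weak v h : (v <= w)%N -> graded x v h -> graded x w h by move=> vw; apply: graded_mono.
have [q0 [q1 aE]] := coef_a_quadratic alpha rho_gt0 (1 - x).
set q2 := _ / _ in aE.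
have n2E n : newton2 alpha rho x n = newton2 alpha rho x 0
    + (newton2 alpha rho x 1 - newton2 alpha rho x 0) * n.
  by rewrite /newton2 /alpha_var; field.
have n3E n : newton3 alpha rho x n = newton3 alpha rho x 0
    + (newton3 alpha rho x 1 - newton3 alpha rho x 0) * n.
  by rewrite /newton3 /alpha_var /alpha_third; field.
have H1 := graded_add g0 (graded_scale (newton1 rho x) (weak _ _ (leq_pred _) g1)).
have l2 : (w.-2 <= w)%N := leq_trans (leq_pred _) (leq_pred _).
have l3 : (w.-1.-2 <= w.-2)%N := leq_pred _.
have l4 : (w.-2.-2 <= w.-2)%N := leq_trans (leq_pred _) (leq_pred _).
have H2 := graded_add (graded_scale (newton2 alpha rho x 0) (weak _ _ l2 g2))
  (graded_scale (newton2 alpha rho x 1 - newton2 alpha rho x 0) (graded_degree (w := w) g2)).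
have H3 := graded_add (graded_scale (newton3 alpha rho x 0) (weak _ _ (leq_trans l3 l2) g3))
  (graded_scale (newton3 alpha rho x 1 - newton3 alpha rho x 0)
     (graded_degree (w := w) (graded_mono l3 g3))).
have H4 := graded_add (graded_add (graded_scale q0 (weak _ _ (leq_trans l4 l2) g4))
  (graded_scale q1 (graded_degree (w := w) (graded_mono l4 g4))))
  (graded_scale q2 (graded_degree (w := w) (graded_degree (w := w.-2) g4))).
apply: (eq_graded (graded_add (graded_add H1 H2) (graded_add H3 H4))) => N k.
by rewrite (stencil_newton _ _ rho_gt0) /newton (n2E (N + 6)%:R) (n3E (N + 6)%:R) aE; ring.
Qed.

Lemma alpha_mean_stencil N n g :
  alpha_mean x alpha N (stencil alpha rho x n g)
  = coef_a alpha rho n x * alpha_mean x alpha N (fun k => g (k + 0)%N)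
    + coef_b alpha rho n x * alpha_mean x alpha N (fun k => g (k + 1)%N)
    + coef_d rho n x * alpha_mean x alpha N (fun k => g (k + 2)%N)
    + coef_b alpha rho n (1 - x) * alpha_mean x alpha N (fun k => g (k + 3)%N)
    + coef_a alpha rho n (1 - x) * alpha_mean x alpha N (fun k => g (k + 4)%N).
Proof.
rewrite -!alpha_meanZ -!alpha_meanD; congr alpha_mean; apply/funext => k.
by rewrite /stencil addn0 addn1 addn2 addn3 addn4.
Qed.

Lemma sum_basis_J N (G : nat -> R) :
  \sum_(0 <= k < (N + 6).+1) basis_J alpha rho (N + 6) k x * G k
  = alpha_mean x alpha N (stencil alpha rho x (N + 6) G).
Proof.
rewrite alpha_mean_stencil.
have SE i : (i <= 4)%N -> alpha_mean x alpha N (fun k => G (k + i)%N)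
    = \sum_(0 <= k < (N + 6).+1)
        alpha_bernstein_shift alpha (N + 6 - 4) k i x * G k.
  move=> i4; rewrite -addnBA // addn2 !addnS addn0.
  by rewrite sum_alpha_bernstein_shift.
rewrite !SE // !mulr_sumr -!big_split /=.
by apply: eq_bigr => k _; rewrite /basis_J; ring.
Qed.

Lemma bernstein_paltanea_J3E N f :
  bernstein_paltanea_J3 alpha rho (N + 6) f x
  = alpha_mean x alpha N
      (stencil alpha rho x (N + 6) (fun k => paltanea_mean rho (N + 6) k f)).
Proof. by rewrite -sum_basis_J. Qed.

Definition cubic_decay (u : nat -> R) :=
  exists C : R, forall N, `|u N| <= C / (N + 6)%:R ^+ 3.

Lemma cubic_decayD u v : cubic_decay u -> cubic_decay v ->
  cubic_decay (fun N => u N + v N).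
Proof.
move=> [C uC] [D vD]; exists (C + D) => N.
by rewrite mulrDl (le_trans (ler_normD _ _)) // lerD.
Qed.

Lemma cubic_decayZ c u : cubic_decay u -> cubic_decay (fun N => c * u N).
Proof. by move=> [C uC]; exists (`|c| * C) => N; rewrite normrM -mulrA ler_wpM2l. Qed.

Lemma degree_gt0 N : 0 < (N + 6)%:R :> R.
Proof. by rewrite ltr0n addn_gt0 orbT. Qed.

(** The rising factorial is at least (rho n)^j. *)
Lemma cubic_decay_rising d j u : (d + 3 <= j)%N -> poly_growth d u ->
  cubic_decay (fun N => u N / rising ((N + 6)%:R * rho + 2) j).
Proof.
move=> dj [C uC]; exists (C / rho ^+ j) => N.
have n0 := degree_gt0 N.
have s0 : 0 < (N + 6)%:R * rho + 2 by rewrite addr_gt0 // mulr_gt0.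
have C0 : 0 <= C.
  by have := le_trans (normr_ge0 _) (uC N); rewrite pmulr_lge0 // exprn_gt0.
rewrite normrM normfV (gtr0_norm (rising_gt0 _ s0)) ler_pdivrMr ?rising_gt0 //.
have rising_ge : ((N + 6)%:R * rho) ^+ j <= rising ((N + 6)%:R * rho + 2) j.
  rewrite /rising -{1}[j]subn0 -prodr_const_nat; apply: ler_prod => i _.
  by rewrite -addrA lerDl !addr_ge0 // mulr_ge0 // ltW.
apply: le_trans (uC N) _.
apply: (@le_trans _ _ (C / rho ^+ j / (N + 6)%:R ^+ 3 * ((N + 6)%:R * rho) ^+ j)); last first.
  by rewrite ler_wpM2l // !divr_ge0 ?exprn_ge0 // ltW.
rewrite exprMn.
have -> : C / rho ^+ j / (N + 6)%:R ^+ 3 * ((N + 6)%:R ^+ j * rho ^+ j)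
    = C * ((N + 6)%:R ^+ j / (N + 6)%:R ^+ 3).
  by field; rewrite !gt_eqF ?exprn_gt0.
rewrite ler_wpM2l // ler_pdivlMr ?exprn_gt0 // -exprD ler_weXn2l //.
by rewrite ler1n addn_gt0 orbT.
Qed.

Lemma stencilD n g h k : stencil alpha rho x n (fun k => g k + h k) k
  = stencil alpha rho x n g k + stencil alpha rho x n h k.
Proof. by rewrite /stencil; ring. Qed.

Lemma stencilZ n c g k : stencil alpha rho x n (fun k => c * g k) k
  = c * stencil alpha rho x n g k.
Proof. by rewrite /stencil; ring. Qed.

Definition stencil_mean N g := alpha_mean x alpha N (stencil alpha rho x (N + 6) g).

Lemma stencil_meanD N g h :
  stencil_mean N (fun k => g k + h k) = stencil_mean N g + stencil_mean N h.
Proof.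
rewrite /stencil_mean -alpha_meanD; congr alpha_mean.
by apply/funext => k; rewrite stencilD.
Qed.

Lemma stencil_meanZ N c g : stencil_mean N (fun k => c * g k) = c * stencil_mean N g.
Proof.
rewrite /stencil_mean -alpha_meanZ; congr alpha_mean.
by apply/funext => k; rewrite stencilZ.
Qed.

Lemma eq_stencil_mean N g h : (forall k, (k <= N + 6)%N -> g k = h k) ->
  stencil_mean N g = stencil_mean N h.
Proof.
move=> gh; apply: eq_alpha_mean => k kN.
have le i : (i <= 4)%N -> (i + k <= N + 6)%N.
  by move=> i4; rewrite [(N + 6)%N]addnC; exact: leq_add i4 kN.
by rewrite /stencil !gh ?(le 0%N) ?(le 1%N) ?(le 2%N) ?(le 3%N) ?(le 4%N).
Qed.

Lemma stencil_mean_cst N : stencil_mean N (fun=> 1) = 1.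
Proof.
rewrite /stencil_mean (_ : stencil _ _ _ _ _ = fun=> 1).
  by rewrite /alpha_mean (_ : mix_step _ _ _ = fun=> 1) ?bernstein_mean_cst //;
     apply/funext => k; rewrite /mix_step; ring.
by apply/funext => k; rewrite (stencil_newton _ _ rho_gt0) /newton /fdiff; ring.
Qed.

Lemma stencil_moment_decay j : (0 < j)%N ->
  cubic_decay (fun N => stencil_mean N
    (fun k => paltanea_num rho x j N k / rising ((N + 6)%:R * rho + 2) j)).
Proof.
move=> j0.
rewrite (_ : (fun N => _) = fun N => stencil_mean N (paltanea_num rho x j N)
   / rising ((N + 6)%:R * rho + 2) j); last first.
  apply/funext => N; rewrite [RHS]mulrC -stencil_meanZ; congr stencil_mean.
  by apply/funext => k; rewrite [LHS]mulrC.
have zero i : (forall N, stencil_mean N (paltanea_num rho x i N) = 0) ->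
    cubic_decay (fun N => stencil_mean N (paltanea_num rho x i N)
      / rising ((N + 6)%:R * rho + 2) i).
  by move=> i0; exists 0 => N; rewrite i0 !mul0r normr0.
case: j j0 => [|[|[|[|[|j]]]]] // _.
- by apply: zero => N; exact: stencil_moment1.
- by apply: zero => N; exact: stencil_moment2.
- by apply: zero => N; exact: stencil_moment3.
- by apply: cubic_decay_rising (stencil_moment4 _ _ rho_gt0).
- (* The numerator of order i = j + 5 has average O(n^floor(i/2)), and
     i - floor(i/2) >= 3. *)
  apply: (@cubic_decay_rising j.+1./2.+2).
    by lia.
  exact: alpha_mean_growth (graded_stencil (graded_paltanea_num rho x j.+1.+4)).
Qed.

(** The five terms are bounded separately: the coefficients cost n^2, the average of
    the tenth numerator is O(n^5), and its denominator is of size n^10. *)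
Lemma stencil_remainder_decay (u : nat -> nat -> R) C :
  0 <= x <= 1 -> 0 <= alpha <= 1 ->
  (forall N k, (k <= N + 6)%N ->
    `|u N k| <= C * (paltanea_num rho x 10 N k / rising ((N + 6)%:R * rho + 2) 10)) ->
  cubic_decay (fun N => stencil_mean N (u N)).
Proof.
move=> x01 al01 uC.
pose r N := rising ((N + 6)%:R * rho + 2) 10.
pose M i N := alpha_mean x alpha N (fun k => paltanea_num rho x 10 N (k + i)%N).
have Mgrowth i : poly_growth 5 (M i).
  apply: (@alpha_mean_growth _ _ alpha 11).
  elim: i => [|i IH].
    by apply: (eq_graded (graded_paltanea_num rho x 10)) => N k; rewrite addn0.
  by apply: (eq_graded (graded_shift IH)) => N k; rewrite addSnnS.
have shift_le i N : (i <= 4)%N ->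
    `|alpha_mean x alpha N (fun k => u N (k + i)%N)| <= `|C / r N * M i N|.
  move=> i4; apply: le_trans (ler_norm _); rewrite /M -alpha_meanZ.
  apply: alpha_mean_norm_le => // k kN.
  have -> : C / r N * paltanea_num rho x 10 N (k + i)
      = C * (paltanea_num rho x 10 N (k + i) / r N) by ring.
  by apply: uC; lia.
have term c i : (i <= 4)%N -> poly_growth 2 c ->
    cubic_decay (fun N => c N * alpha_mean x alpha N (fun k => u N (k + i)%N)).
  move=> i4 c2.
  have [D HD] := cubic_decayZ C
    (@cubic_decay_rising (2 + 5) 10 _ isT (poly_growthM c2 (Mgrowth i))).
  exists D => N; apply: le_trans (HD N).
  rewrite normrM (_ : C * _ = c N * (C / r N * M i N)); last by rewrite /r; ring.
  by rewrite [X in _ <= X]normrM ler_wpM2l // shift_le.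
have [ax bx dx] := coef_growth x; have [ay ady _] := coef_growth (1 - x).
have := cubic_decayD (cubic_decayD (cubic_decayD (cubic_decayD
  (term _ 0%N isT ax) (term _ 1%N isT bx)) (term _ 2%N isT dx))
  (term _ 3%N isT ady)) (term _ 4%N isT ay).
move=> [D HD]; exists D => N; have := HD N.
by rewrite -alpha_mean_stencil.
Qed.

End Final.

Theorem theorem9 (R : realType) (alpha rho : R) (f : R -> R) (x : R)
    (alpha01 : 0 <= alpha <= 1) (rho_gt0 : 0 < rho)
    (f_C10 : continuously_differentiable_on `[0, 1] 10 f)
    (x01 : 0 <= x <= 1) :
  (fun n : nat => bernstein_paltanea_J3 alpha rho n f x - f x)
    =O_\oo (fun n : nat => 1 / n%:R ^+ 3 : R).
Proof.
have [c [C [/(_ isT) c0 fC]]] := taylor_bound f_C10 x01.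
have fc := continuously_differentiable_on_continuous f_C10.
pose P m t := \sum_(0 <= j < m) c j * (t - x) ^+ j.
have mono_c j : {within `[0, 1], continuous (fun t : R => (t - x) ^+ j)}.
  exact/continuous_subspaceT/continuous_center_expr.
have scale_c a (g : R -> R) : {within `[0, 1], continuous g} ->
    {within `[0, 1], continuous (fun t : R => a * g t)}.
  move=> gc; apply: within_continuousM => //.
  by apply: continuous_subspaceT => t; exact: cvg_cst.
have monoZ_c j : {within `[0, 1], continuous (fun t : R => c j * (t - x) ^+ j)}.
  exact: scale_c.
have P_c m : {within `[0, 1], continuous (P m)}.
  elim: m => [|m IH].
    rewrite (_ : P 0%N = cst 0); last by apply/funext => t; rewrite /P big_nil.
    by apply: continuous_subspaceT; exact: cst_continuous.
  rewrite (_ : P m.+1 = P m + (fun t => c m * (t - x) ^+ m)).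
    exact: within_continuousD.
  by apply/funext => t; rewrite /P big_nat_recr.
pose r t := f t - P 10%N t.
have r_c : {within `[0, 1], continuous r} by exact: within_continuousB.
pose J N g := stencil_mean alpha rho x N (fun k => paltanea_mean rho (N + 6) k g).
have JD N (g h : R -> R) : {within `[0, 1], continuous g} -> {within `[0, 1], continuous h} ->
    J N (fun t => g t + h t) = J N g + J N h.
  move=> gc hc; rewrite /J -stencil_meanD; congr stencil_mean.
  by apply/funext => k; rewrite paltanea_meanD.
have JZ N a (g : R -> R) : {within `[0, 1], continuous g} -> J N (fun t => a * g t) = a * J N g.
  move=> gc; rewrite /J -stencil_meanZ; congr stencil_mean.
  by apply/funext => k; rewrite paltanea_meanZ.
have J_center N j : J N (fun t => (t - x) ^+ j) = stencil_mean alpha rho x N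
    (fun k => paltanea_num rho x j N k / rising ((N + 6)%:R * rho + 2) j).
  by apply: eq_stencil_mean => k kN; rewrite paltanea_mean_center.
have P_decay m : cubic_decay (fun N => J N (P m.+1) - f x).
  elim: m => [|m [D HD]].
    exists 0 => N; rewrite mul0r.
    have -> : P 1%N = fun t => c 0%N * (t - x) ^+ 0.
      by apply/funext => t; rewrite /P big_nat1.
    rewrite JZ // J_center c0 (_ : (fun k => _) = fun=> 1).
      by rewrite stencil_mean_cst // mulr1 subrr normr0.
    by apply/funext => k; rewrite /rising big_nil divr1.
  have := cubic_decayD (ex_intro _ D HD)
    (cubic_decayZ (c m.+1) (stencil_moment_decay alpha x rho_gt0 (ltn0Sn m))).
  rewrite (_ : (fun N => _ + _) = (fun N => J N (P m.+2) - f x)) //.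
  apply/funext => N; rewrite -J_center -JZ // addrAC -JD //.
  by congr (J N _ - _); apply/funext => t; rewrite [RHS]/P big_nat_recr.
have r_decay : cubic_decay (fun N => J N r).
  apply: (@stencil_remainder_decay _ alpha rho x rho_gt0 _ C) => // N k kN.
  rewrite -paltanea_mean_center // -paltanea_meanZ //.
  apply: paltanea_mean_norm_le => //; first exact: scale_c.
  move=> t t01; apply: le_trans (fC t t01) _.
  by rewrite -normrX ger0_norm // -[10%N]/(5 * 2)%N exprM sqr_ge0.
have [D HD] := cubic_decayD (P_decay 9%N) r_decay.
apply/eqO_exP; exists (`|D| + 1); first by rewrite ltr_wpDl.
(* The substitution n = N + 6 is available from n = 6 on. *)
exists 6%N => // n /= n6.
have -> : n = (n - 6 + 6)%N by rewrite subnK.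
move: (n - 6)%N => N {n n6}.
rewrite bernstein_paltanea_J3E //.
have -> : alpha_mean x alpha N (stencil alpha rho x (N + 6)
    (fun k => paltanea_mean rho (N + 6) k f)) - f x = J N (P 10%N) - f x + J N r.
  rewrite addrAC -JD //; congr (_ - _).
  rewrite -/(stencil_mean _ _ _ _ _) -/(J N f); congr (J N _).
  by apply/funext => t; rewrite /r subrKC.
apply: le_trans (HD N) _.
have n3 : 0 < (N + 6)%:R ^+ 3 :> R by rewrite exprn_gt0 // ltr0n addn_gt0 orbT.
rewrite div1r normfV (gtr0_norm n3) ler_wpM2r ?invr_ge0 ?(ltW n3) //.
by rewrite (le_trans (ler_norm D)) // lerDl.
Qed.
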